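(* Let the digraphs and weight matrices satisfy Assumption G, and let the constraint set $\Omega$ and the costs $f_{i,t}$ satisfy Assumption C (both stated in the context). For a given time horizon $T\in\mathbb{N}_{+}$, set $\mu=\frac{r}{\sqrt{T+1}}$ and $\xi=\frac{1}{\sqrt{T+1}}$, and let $\{x_{i,t}\}$ be generated by Algorithm 1 (described in the context) with step size $\alpha_t=\frac{1}{m\sqrt{t+1}}$. Then for every node $j\in\mathcal{V}$ the (expected) dynamic regret $\mathcal{R}_j^d(T)=\sum_{t=0}^{T}\mathbb{E}[F_t(x_{j,t})]-\sum_{t=0}^{T}F_t(x_t^\star)$ satisfies $$\mathcal{R}_j^d(T)\le \mathcal{K}_1+\mathcal{K}_2\sqrt{T+1},$$ where, with $L=mG/\mu$, $$\mathcal{K}_1=\frac{nC(2RL\theta+2m\theta\lambda G+G)}{1-\lambda}\sum_{i=1}^{n}\Vert x_{i,0}\Vert+\frac{2n^2\theta CGR}{\lambda(1-\lambda)},$$ $$\mathcal{K}_2=\frac{2n^2\theta CG}{1-\lambda}\left(2\theta RL+2m\theta G+G\right)+nm\theta^2G^2+2nmR^2+nr\theta G+n\theta GR+2nmR\,\mathcal{C}_T.$$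
   Context: Network. There are $n$ nodes $\mathcal{V}=\{1,\dots,n\}$ and digraphs $\mathcal{G}_t=(\mathcal{V},\mathcal{E}_t)$, $t\ge 0$; $(i,j)\in\mathcal{E}_t$ means node $j$ receives information from node $i$ at time $t$. Each node is its own in- and out-neighbor, i.e. $(i,i)\in\mathcal{E}_t$. The weight matrix $\mathcal{A}_t=[a_{ij,t}]\in\mathbb{R}^{n\times n}$ has $a_{ij,t}>0$ if $(j,i)\in\mathcal{E}_t$ and $a_{ij,t}=0$ otherwise. Assumption G: (a) there is $\gamma\in(0,1)$ that lower bounds all nonzero weights $a_{ij,t}$; (b) each $\mathcal{A}_t$ is column-stochastic, $\mathcal{A}_t^{\mathrm T}\mathbf{1}_n=\mathbf{1}_n$; (c) there is a positive integer $B$ such that for every $t$ the union digraph $(\mathcal{V},\bigcup_{l=0}^{B-1}\mathcal{E}_{t+l})$ is strongly connected. Costs. Each $f_{i,t}:\mathbb{R}^m\to\mathbb{R}$ is a (deterministic) convex function, $F_t(x)=\sum_{i=1}^n f_{i,t}(x)$, and $x_t^\star\in\arg\min_{x\in\Omega}F_t(x)$. The path variation is $\mathcal{C}_T=\sum_{t=0}^{T}\Vert x_{t+1}^\star-x_t^\star\Vert$. Assumption C: (a) $\Omega\subseteq\mathbb{R}^m$ is nonempty, convex and closed, and there are $r,R>0$ with $r\mathbb{B}^m\subseteq\Omega\subseteq R\mathbb{B}^m$, where $\mathbb{B}^m$ is the closed Euclidean unit ball; (b) there is $G>0$ such that $\Vert g\Vert\le G$ for all $g\in\partial f_{i,t}(x)$,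 $x\in\Omega$, all $i$ and $t$. Algorithm 1. Parameters: $\xi\in(0,1)$, $\mu\in(0,r\xi]$, step sizes $\alpha_t>0$. Initialize with deterministic $x_{i,0}\in(1-\xi)\Omega=\{(1-\xi)x:x\in\Omega\}$ and $\phi_{i,0}=1$. For $t=0,1,2,\dots$ and each $i$: $$\phi_{i,t+1}=\sum_{j=1}^n a_{ij,t}\phi_{j,t},\qquad b_{ij,t}=\frac{a_{ij,t}\phi_{j,t}}{\phi_{i,t+1}},$$ $$x_{i,t+1}=\mathcal{P}_{(1-\xi)\Omega}\Big(\sum_{j=1}^n b_{ij,t}x_{j,t}-\frac{\alpha_t}{\phi_{i,t+1}}\hat g_{i,t}(x_{i,t})\Big),\qquad \hat g_{i,t}(x)=\frac{m}{\mu}\big(f_{i,t}(x+\mu\zeta_{i,t})-f_{i,t}(x)\big)\zeta_{i,t},$$ where $\mathcal{P}$ is Euclidean projection and the $\zeta_{i,t}$ are independent and uniformly distributed on the unit sphere $\mathbb{S}^m=\{x\in\mathbb{R}^m:\Vert x\Vert=1\}$. Constants $C,\lambda,\theta$. Let $\mathcal{B}_t=[b_{ij,t}]$ (row-stochastic), and $\mathcal{B}(s:t)=\mathcal{B}_{s-1}\cdots\mathcal{B}_t$ for $s\ge t$, with $\mathcal{B}(t:t)=I$ and entries $b_{ij}(s:t)$. Under Assumption G it is known that there exist vectors $\pi_t=[\pi_{1,t},\dots,\pi_{n,t}]^{\mathrm T}$, $t\ge0$, with positive entries, $\mathbf{1}_n^{\mathrm T}\pi_t=1$ and $\pi_t^{\mathrm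 T}=\pi_{t+1}^{\mathrm T}\mathcal{B}_t$, and constants $C>0$, $\lambda\in(0,1)$ with $|b_{ij}(s:t)-\pi_{j,t}|\le C\lambda^{s-t}$ for all $i,j$ and $s\ge t\ge0$; and a constant $\theta>0$ with $\phi_{i,t}\ge\theta^{-1}$ for all $i$ and $t\ge 0$. The symbols $C,\lambda,\theta$ denote such constants. *)

(* Defs.v *)
(* MathComp-Analysis; R : realType plays the role of the real numbers. *)
From HB Require Import structures.
From mathcomp Require Import all_boot all_order all_algebra finmap.
From mathcomp Require Import all_classical all_reals all_analysis.

Set Implicit Arguments.
Unset Strict Implicit.
Unset Printing Implicit Defensive.

Import Order.TTheory GRing.Theory Num.Theory numFieldNormedType.Exports.

Local Open Scope classical_set_scope.
Local Open Scope ring_scope.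

Section Euclidean.
Context {R : realType} {m : nat}.
Implicit Types (u v x y z : 'rV[R]_m) (S : set 'rV[R]_m).

Definition edot u v : R := \sum_(k < m) u 0 k * v 0 k.

(* The canonical norm of 'rV[R]_m in the library is the sup norm. *)
Definition enorm u : R := Num.sqrt (edot u u).

Definition eball (c : R) : set 'rV[R]_m := [set x | enorm x <= c].
Definition esphere : set 'rV[R]_m := [set x | enorm x = 1].

(* z is the Euclidean projection of y on S. *)
Definition is_proj S y z : Prop :=
  S z /\ forall w, S w -> enorm (y - z) <= enorm (y - w).

Definition dilate (c : R) S : set 'rV[R]_m := [set c *: x | x in S].

Definition subdifferential (f : 'rV[R]_m -> R) x : set 'rV[R]_m :=
  [set g | forall y, f x + edot g (y - x) <= f y].

Definition is_argmin S (f : 'rV[R]_m -> R) x : Prop :=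
  S x /\ forall y, S y -> f x <= f y.

Definition borel_rV : set (set 'rV[R]_m) := <<s [set U | open U] >>.

End Euclidean.

Section Network.
Context {R : realType} {n : nat}.
Implicit Types (E : nat -> rel 'I_n) (A : nat -> 'M[R]_n).

(* E t i j: node j receives information from node i at time t. *)
Record weighted_digraphs E A : Prop := WeightedDigraphs {
  self_loops : forall t i, E t i i ;
  weight_gt0 : forall t i j, E t j i -> 0 < A t i j ;
  weight_eq0 : forall t i j, ~~ E t j i -> A t i j = 0 }.

Definition strongly_connected (e : rel 'I_n) : Prop :=
  forall i j, connect e i j.

Definition union_digraph E (t B : nat) : rel 'I_n :=
  fun i j => [exists l : 'I_B, E (t + l)%N i j].

Record network_assumption E A : Prop := NetworkAssumption {
  weight_lower_bound : exists gamma : R, [/\ 0 < gamma, gamma < 1 &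
    forall t i j, A t i j != 0 -> gamma <= A t i j] ;
  column_stochastic : forall t,
    (A t)^T *m (const_mx 1 : 'cV[R]_n) = const_mx 1 ;
  jointly_connected : exists2 B : nat, (0 < B)%N &
    forall t, strongly_connected (union_digraph E t B) }.

Fixpoint phi A (t : nat) : 'cV[R]_n :=
  if t is s.+1 then A s *m phi A s else const_mx 1.

Definition bmx A (t : nat) : 'M[R]_n :=
  \matrix_(i, j) (A t i j * phi A t j 0 / phi A t.+1 i 0).

(* bprod A t k is the backward product B_(t+k-1) ... B_t. *)
Fixpoint bprod A (t k : nat) : 'M[R]_n :=
  if k is l.+1 then bmx A (t + l)%N *m bprod A t l else 1%:M.

Definition mixing_constants A (C lambda theta : R) : Prop :=
  [/\ 0 < C, 0 < lambda < 1, 0 < theta,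
      exists pi : nat -> 'rV[R]_n,
        [/\ forall t i, 0 < pi t 0 i,
            forall t, \sum_i pi t 0 i = 1,
            forall t, pi t = pi t.+1 *m bmx A t &
            forall (s t : nat) i j, (t <= s)%N ->
              `|bprod A t (s - t) i j - pi t 0 j| <= C * lambda ^+ (s - t)]
    & forall t i, theta^-1 <= phi A t i 0].

End Network.

Section Costs.
Context {R : realType} {n m : nat}.
Implicit Types (f : 'I_n -> nat -> 'rV[R]_m -> R) (Omega : set 'rV[R]_m).

Definition total_cost f (t : nat) (x : 'rV[R]_m) : R := \sum_i f i t x.

Definition path_variation (xstar : nat -> 'rV[R]_m) (T : nat) : R :=
  \sum_(0 <= t < T.+1) enorm (xstar t.+1 - xstar t).

Record cost_assumption Omega f (r Rb G : R) : Prop := CostAssumption {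
  constraint_nonempty : Omega !=set0 ;
  constraint_convex : convex_set Omega ;
  constraint_closed : closed Omega ;
  inner_radius_gt0 : 0 < r ;
  outer_radius_gt0 : 0 < Rb ;
  inner_ball : eball r `<=` Omega ;
  outer_ball : Omega `<=` eball Rb ;
  subgradient_bound_gt0 : 0 < G ;
  subgradient_bound : forall i t x, Omega x ->
    forall g, subdifferential (f i t) x g -> enorm g <= G }.

End Costs.

Section Randomness.
Context {d : measure_display} {W : measurableType d} {R : realType}.
Variable P : probability W R.

Definition random_vector {m : nat} (X : W -> 'rV[R]_m) : Prop :=
  forall A, borel_rV A -> measurable (X @^-1` A).

Definition mutually_independent {m : nat} {I : choiceType}
    (X : I -> W -> 'rV[R]_m) : Prop :=
  forall (J : {fset I}) (A : I -> set 'rV[R]_m),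
    (forall k, borel_rV (A k)) ->
    P (\bigcap_(k in [set` J]) (X k @^-1` A k)) =
    (\prod_(k <- J) P (X k @^-1` A k))%E.

(* The uniform distribution on the unit sphere is the Borel probability
   carried by the sphere that is invariant under the orthogonal group
   (normalized Haar, i.e. surface, measure). *)
Definition uniform_on_sphere {m : nat} (X : W -> 'rV[R]_m) : Prop :=
  [/\ random_vector X,
      P (X @^-1` esphere) = 1%E
    & forall Q : 'M[R]_m, Q *m Q^T = 1%:M ->
      forall A, borel_rV A ->
        P ((fun w => X w *m Q) @^-1` A) = P (X @^-1` A)].

End Randomness.

Section Algorithm.
Context {R : realType} {n m : nat} {W : Type}.

Definition gradient_estimate (f : 'rV[R]_m -> R) (mu : R)
    (zeta x : 'rV[R]_m) : 'rV[R]_m :=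
  (m%:R / mu * (f (x + mu *: zeta) - f x)) *: zeta.

(* x i t w is the iterate of node i at time t for the outcome w; the initial
   points x0 do not depend on w. *)
Record generated_iterates (A : nat -> 'M[R]_n) (Omega : set 'rV[R]_m)
    (f : 'I_n -> nat -> 'rV[R]_m -> R) (xi mu : R) (alpha : nat -> R)
    (zeta : 'I_n -> nat -> W -> 'rV[R]_m) (x0 : 'I_n -> 'rV[R]_m)
    (x : 'I_n -> nat -> W -> 'rV[R]_m) : Prop := GeneratedIterates {
  initial_feasible : forall i, dilate (1 - xi) Omega (x0 i) ;
  initial_point : forall i w, x i 0%N w = x0 i ;
  update : forall i t w,
    is_proj (dilate (1 - xi) Omega)
      (\sum_j bmx A t i j *: x j t w
       - (alpha t / phi A t.+1 i 0) *:
           gradient_estimate (f i t) mu (zeta i t w) (x i t w))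
      (x i t.+1 w) }.

End Algorithm.

Definition dynamic_regret {d : measure_display} {W : measurableType d}
    {R : realType} (P : probability W R) {m : nat}
    (F : nat -> 'rV[R]_m -> R) (xstar : nat -> 'rV[R]_m)
    (y : nat -> W -> 'rV[R]_m) (T : nat) : \bar R :=
  (\sum_(0 <= t < T.+1) 'E_P[fun w => F t (y t w)]
   - (\sum_(0 <= t < T.+1) F t (xstar t))%:E)%E.

(* Main.v *)
Require Import Defs.
From HB Require Import structures.
From mathcomp Require Import all_boot all_order all_algebra finmap.
From mathcomp Require Import all_classical all_reals all_analysis.
From mathcomp Require Import measurable_realfun ring lra.

Set Implicit Arguments.
Unset Strict Implicit.
Unset Printing Implicit Defensive.

Import Order.TTheory GRing.Theory Num.Theory numFieldNormedType.Exports.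

Local Open Scope classical_set_scope.
Local Open Scope ring_scope.

(* The function sum_i phi_{i,t} |x_{i,t} - y|^2 decreases along the algorithm up
   to -2 alpha_t sum_i <g_{i,t}, v_{i,t} - y> and a term of order alpha_t^2,
   where v_{i,t} = sum_j b_{ij,t} x_{j,t}: the weights phi cancel the factors
   1/phi of the step, and sum_i phi_{i,t+1} b_{ij,t} = phi_{j,t}.  Abel summation
   with y_t = (1 - xi) xstar_t and the geometric mixing of the products of the
   b_{ij,t} then bound the regret along each outcome, up to the gaps
   f(x_{i,t}) - f(y_t) - <ghat_{i,t}, x_{i,t} - y_t>.

   It remains to see that each gap has mean at most mu G.  Neither the divergence
   theorem nor differentiability of f is used, only the invariance of the law of
   zeta under rotations.  With u = y - x and q(t) = E[<z, u> f(x + t mu z)],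
   averaging over infinitesimal plane rotations expresses (m - 1) q(t) through
   the tangential derivatives of f at x + t mu z, while the increments of q give
   the radial ones; together, by convexity,
     q(t + e) - q(t) + (e / t) (m - 1) q(t) <= e mu (f(y) - f(x) + mu G)
   up to second differences of f.  This discretized differential inequality for
   t^(m-1) q(t) is summed with the weights 'C(k - 1, m - 1) at t = k / N; the
   second differences telescope to O(1/N), and N -> oo gives
   m q(1) <= mu (f(y) - f(x) + mu G). *)


(** * Euclidean geometry of row vectors *)

(** In the limit the inequality for [q] reads q' + (m - 1) q / t <= mu (f(y) - f(x) + mu G);
    multiplied by t^(m-1) it integrates to the bound on m q(1). The mean gap is that of f(x) - f(y)
    + (m / mu) q(1), hence at most mu G. The binomial weights are the discrete t^(m-1) for which the
    product rule is an exact identity. The base point x_{i,t} is itself random, but depends only on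
    directions drawn before time t. The pair (past, direction) therefore has a law invariant under
    rotations of its second component. The analysis uses nothing else, and an abstract mean keeps it
    apart from integration. Directions have unit length only almost surely, so the bound m G on the
    estimates holds only off a null set. This is why the regret is first bounded for deterministic
    sequences, then integrated off one null set common to all nodes and times. The constants
    obtained contain G (2 + m (1 + lambda)); they compare with those of the theorem because r <= Rb
    gives Rb L >= m G. *)

Section EuclideanTheory.
Context {R : realType} {m : nat}.
Implicit Types (u v x y z g : 'rV[R]_m) (S : set 'rV[R]_m).

Lemma edotC u v : edot u v = edot v u.
Proof. by apply: eq_bigr => k _; rewrite mulrC. Qed.

Lemma edotDl u v w : edot (u + v) w = edot u w + edot v w.
Proof. by rewrite -big_split; apply: eq_bigr => k _; rewrite mxE mulrDl. Qed.

Lemma edotZl c u w : edot (c *: u) w = c * edot u w.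
Proof. by rewrite mulr_sumr; apply: eq_bigr => k _; rewrite mxE mulrA. Qed.

Lemma edotNl u w : edot (- u) w = - edot u w.
Proof. by rewrite -scaleN1r edotZl mulN1r. Qed.

Lemma edotBl u v w : edot (u - v) w = edot u w - edot v w.
Proof. by rewrite edotDl edotNl. Qed.

Lemma edotDr u v w : edot w (u + v) = edot w u + edot w v.
Proof. by rewrite edotC edotDl !(edotC w). Qed.

Lemma edotZr c u w : edot w (c *: u) = c * edot w u.
Proof. by rewrite edotC edotZl edotC. Qed.

Lemma edotNr u w : edot w (- u) = - edot w u.
Proof. by rewrite edotC edotNl edotC. Qed.

Lemma edotBr u v w : edot w (u - v) = edot w u - edot w v.
Proof. by rewrite edotDr edotNr. Qed.

Lemma edot0l u : edot 0 u = 0.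
Proof. by rewrite -(scale0r 0) edotZl mul0r. Qed.

Lemma edot0r u : edot u 0 = 0.
Proof. by rewrite edotC edot0l. Qed.

Lemma edot_suml (I : Type) (s : seq I) (F : I -> 'rV[R]_m) w :
  edot (\sum_(i <- s) F i) w = \sum_(i <- s) edot (F i) w.
Proof. exact: (big_morph (fun v => edot v w) (fun u v => edotDl u v w) (edot0l w)). Qed.

Lemma edot_delta u k : edot u (delta_mx 0 k) = u 0 k.
Proof.
rewrite /edot (bigD1 k)//= mxE !eqxx mulr1 big1 ?addr0// => i ik.
by rewrite mxE eqxx (negbTE ik) mulr0.
Qed.

Lemma edot_ge0 u : 0 <= edot u u.
Proof. by apply: sumr_ge0 => k _; rewrite -expr2 sqr_ge0. Qed.

Lemma enorm_ge0 u : 0 <= enorm u. Proof. exact: sqrtr_ge0. Qed.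

Lemma sqr_enorm u : enorm u ^+ 2 = edot u u.
Proof. by rewrite sqr_sqrtr ?edot_ge0. Qed.

Lemma enorm_le u c : 0 <= c -> edot u u <= c ^+ 2 -> enorm u <= c.
Proof. by move=> c0 uc; rewrite -(ger0_norm c0) -sqrtr_sqr ler_wsqrtr. Qed.

Lemma enormZ c u : enorm (c *: u) = `|c| * enorm u.
Proof. by rewrite /enorm edotZl edotZr mulrA -expr2 sqrtrM ?sqr_ge0// sqrtr_sqr. Qed.

Lemma enormN u : enorm (- u) = enorm u.
Proof. by rewrite -scaleN1r enormZ normrN1 mul1r. Qed.

Lemma enormBC u v : enorm (u - v) = enorm (v - u).
Proof. by rewrite -enormN opprB. Qed.

Lemma enorm0 : enorm (0 : 'rV[R]_m) = 0.
Proof. by rewrite -(scale0r 0) enormZ normr0 mul0r. Qed.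

Lemma coord_le_enorm u k : `|u 0 k| <= enorm u.
Proof.
rewrite -sqrtr_sqr ler_wsqrtr// /edot (bigD1 k)//= -expr2 lerDl.
by apply: sumr_ge0 => i _; rewrite -expr2 sqr_ge0.
Qed.

Lemma enorm_eq0 u : enorm u = 0 -> u = 0.
Proof.
move=> u0; apply/rowP => k; rewrite mxE; apply/eqP.
by rewrite -normr_le0 -u0 coord_le_enorm.
Qed.

(** The square of |v| u - |u| v is nonnegative, and it equals 2 |u| |v| times the difference of the
    two sides. *)
Lemma edot_le u v : edot u v <= enorm u * enorm v.
Proof.
have [/enorm_eq0 ->|v0] := eqVneq (enorm v) 0; first by rewrite edot0r enorm0 mulr0.
have [/enorm_eq0 ->|u0] := eqVneq (enorm u) 0; first by rewrite edot0l enorm0 mul0r.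
have := edot_ge0 (enorm v *: u - enorm u *: v).
rewrite edotBl !edotBr !edotZl !edotZr -!sqr_enorm (edotC v u).
have a0 : 0 < enorm u by rewrite lt_neqAle eq_sym u0 enorm_ge0.
have b0 : 0 < enorm v by rewrite lt_neqAle eq_sym v0 enorm_ge0.
move=> ?; rewrite -(ler_pM2l (mulr_gt0 a0 b0)); lra.
Qed.

Lemma edot_ge u v : - (enorm u * enorm v) <= edot u v.
Proof. by rewrite lerNl -edotNl (le_trans (edot_le _ _))// enormN. Qed.

Lemma norm_edot u v : `|edot u v| <= enorm u * enorm v.
Proof. by rewrite ler_norml edot_le edot_ge. Qed.

Lemma enormD u v : enorm (u + v) <= enorm u + enorm v.
Proof.
apply: enorm_le; first by rewrite addr_ge0 ?enorm_ge0.
rewrite edotDl !edotDr -!sqr_enorm (edotC v u).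
have := edot_le u v; nra.
Qed.

Lemma enormB u v : enorm (u - v) <= enorm u + enorm v.
Proof. by rewrite (le_trans (enormD _ _))// enormN. Qed.

Lemma enorm_sum (I : Type) (s : seq I) (F : I -> 'rV[R]_m) :
  enorm (\sum_(i <- s) F i) <= \sum_(i <- s) enorm (F i).
Proof.
elim/big_ind2 : _ => //; first by rewrite enorm0.
by move=> u a v b ua vb; rewrite (le_trans (enormD _ _))// lerD.
Qed.

Lemma enorm_le_sum u : enorm u <= \sum_k `|u 0 k|.
Proof.
rewrite {1}[u]row_sum_delta; apply: le_trans (enorm_sum _ _) _.
apply: ler_sum => k _; rewrite enormZ ler_piMr//.
by apply: enorm_le => //; rewrite edot_delta mxE !eqxx expr1n.
Qed.

Lemma sqr_enormD u v :
  enorm (u + v) ^+ 2 = enorm u ^+ 2 + 2 * edot u v + enorm v ^+ 2.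
Proof. by rewrite !sqr_enorm edotDl !edotDr (edotC v u); ring. Qed.

Lemma sqr_enormB u v :
  enorm (u - v) ^+ 2 = enorm u ^+ 2 - 2 * edot u v + enorm v ^+ 2.
Proof. by rewrite sqr_enormD edotNr enormN mulrN. Qed.

Lemma edot_mulmx u v (Q : 'M[R]_m) : edot (u *m Q) v = edot u (v *m Q^T).
Proof.
have dotE a b : edot a b = (a *m b^T) 0 0.
  by rewrite mxE; apply: eq_bigr => k _; rewrite mxE.
by rewrite !dotE trmx_mul trmxK mulmxA.
Qed.

Lemma enorm_orthogonal u (Q : 'M[R]_m) :
  Q *m Q^T = 1%:M -> enorm (u *m Q) = enorm u.
Proof. by move=> QQ; rewrite /enorm edot_mulmx -mulmxA QQ mulmx1. Qed.

End EuclideanTheory.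

(** * Existence of subgradients of convex functions *)

Section Subgradients.
Context {R : realType} {m : nat}.
Implicit Types (u v x y z g : 'rV[R]_m) (S : set 'rV[R]_m) (f : 'rV[R]_m -> R).

Lemma convex_functionP f : convex_function setT f ->
  forall x y t, 0 <= t -> t <= 1 ->
    f (t *: x + (1 - t) *: y) <= t * f x + (1 - t) * f y.
Proof.
move=> cf x y t t0 t1.
by have := cf (Itv01 t0 t1) x y (in_setT _) (in_setT _); rewrite convRE.
Qed.

Lemma convex_setP S : convex_set S ->
  forall x y t, 0 <= t -> t <= 1 -> S x -> S y -> S (t *: x + (1 - t) *: y).
Proof.
move=> cS x y t t0 t1 Sx Sy.
by have := cS x y (Itv01 t0 t1) (mem_set Sx) (mem_set Sy) => /set_mem.
Qed.

(* The one-dimensional extension step of the Hahn-Banach theorem. *)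
Lemma subgradient_step (p : 'rV[R]_m -> R) (V : set 'rV[R]_m) g e :
  (forall x y t, 0 <= t -> t <= 1 ->
    p (t *: x + (1 - t) *: y) <= t * p x + (1 - t) * p y) ->
  V 0 -> (forall x y t, 0 <= t -> t <= 1 -> V x -> V y -> V (t *: x + (1 - t) *: y)) ->
  (forall v, V v -> edot g v <= p v) ->
  exists c : R, forall v (t : R), V v -> edot g v + t * c <= p (v + t *: e).
Proof.
move=> cp V0 cV gp.
(* Lower bounds on the slope [c], imposed by the negative multiples of [e]; the positive ones impose
   upper bounds, and [key] compares the two kinds. *)
pose L := [set c | exists v s, [/\ V v, 0 < s & c = (edot g v - p (v - s *: e)) / s]].
have key v s v' t : V v -> 0 < s -> V v' -> 0 < t ->
    (edot g v - p (v - s *: e)) / s <= (p (v' + t *: e) - edot g v') / t.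
  move=> Vv s0 Vv' t0; have st0 : 0 < s + t by rewrite addr_gt0.
  (* With this weight the multiples of [e] cancel and the convex combination falls back into [V],
     where [g] is already dominated. *)
  pose l := t / (s + t).
  have l1E : 1 - l = s / (s + t) by rewrite /l; field; rewrite gt_eqF.
  have l0 : 0 <= l by rewrite divr_ge0// ltW.
  have l1 : l <= 1 by rewrite -subr_ge0 l1E divr_ge0// ltW.
  have := cp (v - s *: e) (v' + t *: e) l l0 l1.
  have -> : l *: (v - s *: e) + (1 - l) *: (v' + t *: e) = l *: v + (1 - l) *: v'.
    rewrite l1E /l !scalerDr scalerN !scalerA addrACA; set a := _ *: e.
    set b := _ *: e; rewrite (_ : b = a) ?addNr ?addr0//.
    by rewrite /a /b; congr (_ *: _); ring.
  move=> /(le_trans (gp _ (cV _ _ _ l0 l1 Vv Vv'))); rewrite edotDr !edotZr l1E /l.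
  set X := edot g v; set Y := edot g v'; set A := p _; set B := p _.
  rewrite -(ler_pM2l st0).
  have -> : (s + t) * (t / (s + t) * X + s / (s + t) * Y) = t * X + s * Y.
    by field; rewrite gt_eqF.
  have -> : (s + t) * (t / (s + t) * A + s / (s + t) * B) = t * A + s * B.
    by field; rewrite gt_eqF.
  move=> H; rewrite ler_pdivrMr// mulrAC ler_pdivlMr//; lra.
have L0 : L !=set0 by exists ((edot g 0 - p (0 - 1 *: e)) / 1), 0, 1; split.
have Lub : has_ubound L.
  exists ((p (0 + 1 *: e) - edot g 0) / 1) => _ [v [s [Vv s0 ->]]]; exact: key.
exists (sup L) => v t Vv; have [t0|t0|->] := ltgtP t 0.
- have : L ((edot g v - p (v - (- t) *: e)) / (- t)).
    by exists v, (- t); rewrite oppr_gt0; split.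
  move=> /(ub_le_sup Lub); rewrite ler_pdivrMr ?oppr_gt0// scaleNr opprK; lra.
- have : sup L <= (p (v + t *: e) - edot g v) / t.
    by apply: ge_sup => // _ [v' [s [Vv' s0 ->]]]; exact: key.
  rewrite ler_pdivlMr//; lra.
- by rewrite mul0r scale0r !addr0 gp.
Qed.

(** The zero functional is extended one coordinate at a time: [V k] holds the vectors supported on
    the first [k] coordinates, and [V m] is the whole space. *)
Lemma subdifferential_nonempty f x :
  convex_function setT f -> subdifferential f x !=set0.
Proof.
move=> /convex_functionP cf; pose p v := f (x + v) - f x.
have cp u v t : 0 <= t -> t <= 1 ->
    p (t *: u + (1 - t) *: v) <= t * p u + (1 - t) * p v.
  move=> t0 t1; rewrite /p.
  have -> : x + (t *: u + (1 - t) *: v) = t *: (x + u) + (1 - t) *: (x + v).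
    by apply/rowP => k; rewrite !mxE; ring.
  by have := cf (x + u) (x + v) t t0 t1; lra.
pose V k := [set v : 'rV[R]_m | forall i : 'I_m, (k <= i)%N -> v 0 i = 0].
suff /(_ m (leqnn _)) [g Hg] : forall k, (k <= m)%N ->
    exists g, forall v, V k v -> edot g v <= p v.
  exists g => y; have : V m (y - x) by move=> i; rewrite leqNgt ltn_ord.
  by move=> /Hg; rewrite /p (_ : x + (y - x) = y); [lra|rewrite addrC subrK].
elim=> [_|k IHk km].
  exists 0 => v Vv; rewrite edot0l (_ : v = 0) /p ?addr0 ?subrr//.
  by apply/rowP => i; rewrite mxE Vv.
have [g gp] := IHk (ltnW km); pose ik := Ordinal km.
have [||c Hc] := @subgradient_step p (V k) g (delta_mx 0 ik) cp _ _ gp.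
- by move=> i _; rewrite mxE.
- by move=> u v t _ _ Vu Vv i ki; rewrite !mxE Vu// Vv// !mulr0 addr0.
(* This is [g] with coordinate [k] replaced by the slope [c]. *)
exists (g + (c - g 0 ik) *: delta_mx 0 ik) => v Vv.
pose v' := v - v 0 ik *: delta_mx 0 ik.
have Vv' : V k v'.
  move=> i; rewrite leq_eqVlt => /predU1P[ki|ki].
    have -> : i = ik by exact/val_inj.
    by rewrite !mxE !eqxx mulr1 subrr.
  by rewrite !mxE (Vv _ ki) -[i == ik]val_eqE /= gtn_eqF// mulr0 subr0.
have := Hc v' (v 0 ik) Vv'; rewrite /v' subrK; apply: le_trans.
rewrite edotDl edotZl edotBr edotZr (edotC (delta_mx _ _) v) !edot_delta.
by lra.
Qed.

Lemma subgradient_lipschitz f x y g : subdifferential f x g ->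
  f x - f y <= enorm g * enorm (x - y).
Proof.
move=> /(_ y) H; have := edot_ge g (y - x).
by rewrite (enormBC y x); lra.
Qed.

End Subgradients.

(** * Projections on convex sets and convex combinations *)

Section Projections.
Context {R : realType} {m : nat}.
Implicit Types (u v x y z g : 'rV[R]_m) (S : set 'rV[R]_m).

(** Were the product [d] positive, moving from [z] towards [w] by a fraction [t] would shorten the
    distance to [y]. The value [d / (d + n2)] is at most 1 and small enough for the linear gain to
    beat the quadratic loss. *)
Lemma proj_obtuse S y z w : convex_set S -> is_proj S y z -> S w ->
  edot (y - z) (w - z) <= 0.
Proof.
move=> /convex_setP cS [Sz zmin] Sw; rewrite leNgt; apply/negP => d0.
set d := edot _ _ in d0; set n2 := enorm (w - z) ^+ 2.
have n20 : 0 <= n2 by exact: sqr_ge0.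
pose t := d / (d + n2).
have dn0 : 0 < d + n2 by rewrite ltr_pwDl.
have t0 : 0 < t by exact: divr_gt0.
have t1 : t <= 1 by rewrite ler_pdivrMr// mul1r lerDl.
have := zmin _ (cS w z t (ltW t0) t1 Sw Sz).
have -> : y - (t *: w + (1 - t) *: z) = (y - z) - t *: (w - z).
  by apply/rowP => k; rewrite !mxE; ring.
rewrite -(ler_pXn2r (ltn0Sn 1)) ?nnegrE ?enorm_ge0// (sqr_enormB (y - z)) edotZr enormZ.
rewrite exprMn real_normK ?num_real// -/d -/n2 => H.
have : 2 * d <= t * n2 by rewrite -(ler_pM2l t0); lra.
have : t * (d + n2) = d by rewrite /t divfK// gt_eqF.
nra.
Qed.

(** The obtuse angles at [z] and at [z'] add up to |z - z'|^2 <= <y - y', z - z'>. *)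
Lemma proj_nonexpansive S y z y' z' : convex_set S ->
  is_proj S y z -> is_proj S y' z' -> enorm (z - z') <= enorm (y - y').
Proof.
move=> cS p p'; have := proj_obtuse cS p p'.1; have := proj_obtuse cS p' p.1.
move=> h h'; have : enorm (z - z') ^+ 2 <= edot (y - y') (z - z').
  by rewrite sqr_enorm; move: h h'; rewrite !edotBl !edotBr; lra.
move=> H; have := edot_le (y - y') (z - z').
have := enorm_ge0 (z - z'); have := enorm_ge0 (y - y') => y0 z0 yz.
by rewrite leNgt; apply/negP => ?; nra.
Qed.

Lemma proj_fixed S v : S v -> is_proj S v v.
Proof. by move=> Sv; split => // w Sw; rewrite subrr enorm0 enorm_ge0. Qed.

Lemma proj_dist S y z w : convex_set S -> is_proj S y z -> S w ->
  enorm (z - w) <= enorm (y - w).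
Proof. by move=> cS p Sw; exact: proj_nonexpansive cS p (proj_fixed Sw). Qed.

Lemma convex_dilate c S : convex_set S -> convex_set (dilate c S).
Proof.
move=> /convex_setP cS _ _ t /set_mem[x Sx <-] /set_mem[y Sy <-].
apply: mem_set; exists (t%:num *: x + (1 - t%:num) *: y).
  exact: cS.
by rewrite scalerDr !scalerA [c * t%:num]mulrC [c * _]mulrC -!scalerA.
Qed.

Lemma convex_comb S (I : finType) (w : I -> R) (X : I -> 'rV[R]_m) :
  convex_set S -> (forall i, 0 <= w i) -> \sum_i w i = 1 -> (forall i, S (X i)) ->
  S (\sum_i w i *: X i).
Proof.
move=> /convex_setP cS w0 w1 SX.
(* Partial sums are normalized so that the induction stays among convex combinations; the total
   weight 1 enters only at the end. *)
suff H : forall s : seq I, 0 < \sum_(i <- s) w i ->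
    S ((\sum_(i <- s) w i)^-1 *: \sum_(i <- s) w i *: X i).
  by have := H (index_enum I); rewrite w1 invr1 scale1r; exact.
elim=> [|i s IHs]; first by rewrite big_nil ltxx.
rewrite !big_cons; set W := \sum_(j <- s) w j; set Y := \sum_(j <- s) _ => H.
have W0 : 0 <= W by rewrite sumr_ge0.
have [We|Wn] := eqVneq W 0.
  have Y0 : Y = 0.
    rewrite /Y big_seq big1// => j js; suff -> : w j = 0 by rewrite scale0r.
    apply/eqP; rewrite eq_le w0 andbT -We /W.
    rewrite (big_rem j)//= lerDl sumr_ge0// => k _; exact: w0.
  rewrite We Y0 !addr0 in H *.
  by rewrite scalerA mulVf ?scale1r// gt_eqF.
have Wgt : 0 < W by rewrite lt_neqAle eq_sym Wn.
have -> : (w i + W)^-1 *: (w i *: X i + Y) =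
    (w i / (w i + W)) *: X i + (1 - w i / (w i + W)) *: (W^-1 *: Y).
  rewrite scalerDr !scalerA; congr (_ *: _ + _ *: _); first by rewrite mulrC.
  by field; rewrite Wn gt_eqF.
apply: cS => //; [|by rewrite ler_pdivrMr// mul1r lerDl|exact: IHs].
by rewrite divr_ge0// ltW.
Qed.

End Projections.

(** The difference of the two sides is the weighted variance of the points [X i]. *)
Lemma sqr_enorm_convex (R : realType) m (I : finType) (w : I -> R)
    (X : I -> 'rV[R]_m) y :
  (forall i, 0 <= w i) -> \sum_i w i = 1 ->
  enorm (\sum_i w i *: X i - y) ^+ 2 <= \sum_i w i * enorm (X i - y) ^+ 2.
Proof.
move=> w0 w1; have -> : \sum_i w i *: X i - y = \sum_i w i *: (X i - y).
  rewrite -[y in LHS]scale1r -w1 scaler_suml -sumrB.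
  by apply: eq_bigr => i _; rewrite scalerBr.
set Y := \sum_i _; rewrite -subr_ge0.
have -> : \sum_i w i * enorm (X i - y) ^+ 2 - enorm Y ^+ 2
    = \sum_i w i * enorm ((X i - y) - Y) ^+ 2; last first.
  by apply: sumr_ge0 => i _; rewrite mulr_ge0 ?sqr_ge0.
transitivity (\sum_i (w i * enorm (X i - y) ^+ 2 - 2 * edot (w i *: (X i - y)) Y
    + w i * enorm Y ^+ 2)).
  rewrite big_split/= -mulr_suml w1 mul1r sumrB -mulr_sumr -edot_suml -/Y -sqr_enorm.
  by ring.
by apply: eq_bigr => i _; rewrite (sqr_enormB (X i - y)) edotZl; ring.
Qed.

(** * Plane rotations and pointwise inequalities *)

Section PlaneRotations.
Context {R : realType} {m : nat}.
Implicit Types (z : 'rV[R]_m) (i j : 'I_m) (c s : R).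

(** [c] and [s] stand for a cosine and a sine. For distinct [i] and [j], a row vector has its
    coordinate [i] sent to c z_i - s z_j and its coordinate [j] to c z_j + s z_i. *)
Definition plane_rotation i j c s : 'M[R]_m :=
  1%:M + (c - 1) *: (delta_mx i i + delta_mx j j)
       + s *: (delta_mx i j - delta_mx j i).

Lemma plane_rotationE i j c s z :
  z *m plane_rotation i j c s =
  z + (c - 1) *: (z 0 i *: delta_mx 0 i + z 0 j *: delta_mx 0 j)
    + s *: (z 0 i *: delta_mx 0 j - z 0 j *: delta_mx 0 i).
Proof.
have zE k l : z *m delta_mx k l = z 0 k *: delta_mx 0 l.
  apply/rowP => a; rewrite !mxE (bigD1 k)//= !mxE !eqxx/= big1 ?addr0// => b bk.
  by rewrite mxE (negbTE bk) mulr0.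
by rewrite !mulmxDr mulmx1 -!scalemxAr mulmxDr mulmxBr !zE.
Qed.

Lemma tr_plane_rotation i j c s :
  (plane_rotation i j c s)^T = plane_rotation i j c (- s).
Proof.
apply/matrixP => a b; rewrite !mxE [b == a]eq_sym.
by rewrite ![(b == _) && _]andbC; ring.
Qed.

Lemma plane_rotation_orthogonal i j c s : i != j -> c ^+ 2 + s ^+ 2 = 1 ->
  plane_rotation i j c s *m (plane_rotation i j c s)^T = 1%:M.
Proof.
move=> ij cs1; apply/row_matrixP => k.
rewrite !rowE mulmxA mulmx1 tr_plane_rotation; move: (delta_mx 0 k) => z.
rewrite plane_rotationE; set z' := z *m _.
have z'i : z' 0 i = c * z 0 i - s * z 0 j.
  rewrite /z' plane_rotationE !mxE !eqxx ?[j == i]eq_sym (negbTE ij) /=; ring.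
have z'j : z' 0 j = c * z 0 j + s * z 0 i.
  rewrite /z' plane_rotationE !mxE !eqxx ?[j == i]eq_sym (negbTE ij) /=; ring.
rewrite z'i z'j /z' plane_rotationE; apply/rowP => a; rewrite !mxE.
have s2 : s ^+ 2 = 1 - c ^+ 2 by rewrite -cs1; ring.
ring: s2.
Qed.

Lemma plane_rotationNK i j c s z : i != j -> c ^+ 2 + s ^+ 2 = 1 ->
  z *m plane_rotation i j c s *m plane_rotation i j c (- s) = z.
Proof.
by move=> ij cs; rewrite -mulmxA -tr_plane_rotation plane_rotation_orthogonal// mulmx1.
Qed.

Lemma plane_rotationNl i j c s z : i != j ->
  (z *m plane_rotation i j c (- s)) 0 i = c * z 0 i + s * z 0 j.
Proof.
by move=> ij; rewrite plane_rotationE !mxE !eqxx (negbTE ij) /=; ring.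
Qed.

End PlaneRotations.

Section PointwiseInequalities.
Context {R : realType} {m : nat}.
Implicit Types (f : 'rV[R]_m -> R) (x z g u : 'rV[R]_m).

(** Let a and b be the increments of [f] for the angles of sines [s] and [- s], each minus its
    linear part. The subgradient inequality gives a, b >= - 2 e G s^2, whence |a| <= a + b + 6 e G
    s^2. The linear parts cancel in a + b, a second difference whose mean vanishes by invariance. *)
Lemma rotation_defect f x g z i j c s e G : i != j -> c ^+ 2 + s ^+ 2 = 1 ->
  c <= 1 -> 1 - c <= s ^+ 2 -> enorm z = 1 -> 0 <= e ->
  subdifferential f (x + e *: z) g -> enorm g <= G ->
  `|f (x + e *: (z *m plane_rotation i j c s)) - f (x + e *: z)
     - e * s * (z 0 i * g 0 j - z 0 j * g 0 i)|
  <= f (x + e *: (z *m plane_rotation i j c s))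
     + f (x + e *: (z *m plane_rotation i j c (- s))) - 2 * f (x + e *: z)
     + 6 * e * G * s ^+ 2.
Proof.
move=> ij cs c1 cs2 z1 e0 fg gG.
have base s' : s' ^+ 2 = s ^+ 2 ->
    e * s' * (z 0 i * g 0 j - z 0 j * g 0 i) - 2 * e * G * s ^+ 2 <=
    f (x + e *: (z *m plane_rotation i j c s')) - f (x + e *: z).
  move=> s's; have := fg (x + e *: (z *m plane_rotation i j c s')).
  rewrite opprD addrACA subrr add0r -scalerBr edotZr.
  rewrite [_ - z](_ : _ = (c - 1) *: (z 0 i *: delta_mx 0 i + z 0 j *: delta_mx 0 j)
      + s' *: (z 0 i *: delta_mx 0 j - z 0 j *: delta_mx 0 i)); last first.
    by rewrite plane_rotationE; apply/rowP => k; rewrite !mxE; ring.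
  rewrite edotDr !edotZr edotDr edotBr !edotZr !edot_delta.
  have b k : `|z 0 k * g 0 k| <= G.
    rewrite normrM -[G]mul1r ler_pM//; first by rewrite -z1 coord_le_enorm.
    by rewrite (le_trans (coord_le_enorm _ _)).
  have := b i; have := b j; rewrite !ler_norml => /andP[j1 j2] /andP[i1 i2].
  set A := z 0 i * g 0 i in i1 i2 *; set B := z 0 j * g 0 j in j1 j2 *.
  have : (1 - c) * (A + B) <= s ^+ 2 * (2 * G).
    apply: (@le_trans _ _ ((1 - c) * (2 * G))).
      by rewrite ler_wpM2l ?subr_ge0//; lra.
    by rewrite ler_wpM2r//; lra.
  move=> /(ler_wpM2l e0); set X := f _; set Y := f _; lra.
have H1 := base s erefl; have H2 := base (- s) (sqrrN s).
have G0 : 0 <= G by exact: le_trans (enorm_ge0 g) gG.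
have H0 : 0 <= e * G * s ^+ 2 by rewrite mulr_ge0 ?sqr_ge0// mulr_ge0.
by rewrite ler_norml; apply/andP; split; lra.
Qed.

(** The weight [k] has no sign, so the subgradient inequality cannot simply be multiplied by it. The
    forward and backward defects are both nonnegative and add up to the second difference, which
    allows [k] to be replaced by its bound [U]. *)
Lemma radial_defect f x g z a b k U : 0 <= b -> `|k| <= U ->
  subdifferential f (x + a *: z) g ->
  k * (f (x + (a + b) *: z) - f (x + a *: z)) <= b * k * edot g z
    + U * (f (x + (a + b) *: z) - 2 * f (x + a *: z) + f (x + (a - b) *: z)).
Proof.
move=> b0 kU fg; have := fg (x + (a + b) *: z); have := fg (x + (a - b) *: z).
have E t : x + (a + t) *: z - (x + a *: z) = t *: z.
  by apply/rowP => l; rewrite !mxE; ring.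
rewrite !E !edotZr mulNr; set X := f _; set Y := f _; set Z := f _.
move: kU; rewrite ler_norml => /andP[k1 k2] H1 H2.
have : 0 <= (U - k) * (Z - X - b * edot g z) by rewrite mulr_ge0; lra.
have : 0 <= U * (Y - X + b * edot g z) by rewrite mulr_ge0; lra.
by have := H1; have := H2; lra.
Qed.

(** The field z_i e_j - z_j e_i is the velocity of a plane rotation. The right-hand side is the
    product of [g] with the part of [u] tangent to the sphere at [z], which these fields recover. *)
Lemma sum_rotation_fields z g u : enorm z = 1 ->
  \sum_(p : 'I_m * 'I_m | p.1 != p.2)
     u 0 p.2 * z 0 p.1 * (z 0 p.1 * g 0 p.2 - z 0 p.2 * g 0 p.1)
  = edot g u - edot z u * edot g z.
Proof.
move=> z1; transitivity (\sum_(p : 'I_m * 'I_m)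
     u 0 p.2 * z 0 p.1 * (z 0 p.1 * g 0 p.2 - z 0 p.2 * g 0 p.1)).
  rewrite big_mkcond; apply: eq_bigr => -[i j] _ /=.
  by case: eqVneq => //= ->; rewrite subrr mulr0.
rewrite -(pair_bigA _ (fun i j =>
  u 0 j * z 0 i * (z 0 i * g 0 j - z 0 j * g 0 i)))/= exchange_big/=.
have zz : edot z z = 1 by rewrite -sqr_enorm z1 expr1n.
rewrite -[edot g u]mul1r -zz (edotC g u) (edotC z u) /edot.
rewrite !big_distrlr/= [X in _ - X]exchange_big -sumrB exchange_big.
apply: eq_bigr => i _; rewrite -sumrB; apply: eq_bigr => j _.
ring.
Qed.

End PointwiseInequalities.

(** * The mean of the gradient estimate *)

(* [D] is a class of integrands of a base point and a unit vector, and [M]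
   averages them so that only the law of the unit vector matters. *)
Record rotation_invariant_mean {R : realType} {m : nat} {W : Type}
    (D : (W -> 'rV[R]_m -> R) -> Prop) (M : (W -> 'rV[R]_m -> R) -> R) : Prop :=
  RotationInvariantMean {
  dom_cst : forall c, D (fun _ _ => c) ;
  dom_coord : forall k, D (fun _ z => z 0 k) ;
  dom_add : forall a b, D a -> D b -> D (fun w z => a w z + b w z) ;
  dom_mul : forall a b, D a -> D b -> D (fun w z => a w z * b w z) ;
  dom_rot : forall a (Q : 'M[R]_m), Q *m Q^T = 1%:M -> D a -> D (fun w z => a w (z *m Q)) ;
  mean_cst : forall c, M (fun _ _ => c) = c ;
  mean_add : forall a b, D a -> D b -> M (fun w z => a w z + b w z) = M a + M b ;
  mean_scale : forall c a, D a -> M (fun w z => c * a w z) = c * M a ;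
  mean_le : forall a b, D a -> D b ->
    (forall w z, enorm z = 1 -> a w z <= b w z) -> M a <= M b ;
  mean_rot : forall a (Q : 'M[R]_m), Q *m Q^T = 1%:M -> D a ->
    M (fun w z => a w (z *m Q)) = M a }.

(** [s] is kept below 1 so that it can be the sine of a rotation angle. *)
Lemma le_of_le_add_small (R : realType) (a b K : R) :
  (forall s, 0 < s -> s < 1 -> a <= b + s * K) -> a <= b.
Proof.
move=> H; rewrite leNgt; apply/negP => ba; have ab0 : 0 < a - b by rewrite subr_gt0.
pose s := (a - b) / (a - b + `|K| + 1); have := normr_ge0 K => K0.
have d0 : 0 < a - b + `|K| + 1 by lra.
have s0 : 0 < s by exact: divr_gt0.
have s1 : s < 1 by rewrite ltr_pdivrMr//; lra.
have := H s s0 s1; have : s * K <= s * `|K| by rewrite ler_pM2l// ler_norm.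
have : s * (a - b + `|K| + 1) = a - b by rewrite divfK// gt_eqF.
nra.
Qed.

(** A discrete form of (t^M q)' <= t^M (d + e). Since 'C(k - 1, M) = (1 - M / k) 'C(k, M), the
    hypothesis weighted by 'C(k, M) telescopes. The hockey-stick sum 'C(N, M + 1) and (M + 1) 'C(N,
    M + 1) = N 'C(N - 1, M) then give the factor of [d]; for [e] the weights are bounded by the last
    one. *)
Lemma binomial_gronwall (R : realFieldType) (M N : nat) (q e : nat -> R) (d : R) :
  (M < N)%N -> (forall k, (k < N)%N -> 0 <= e k) -> q 1%N <= d + e 0%N ->
  (forall k, (0 < k < N)%N ->
     q k.+1 - q k + M%:R / k%:R * q k <= d + e k) ->
  M.+1%:R * q N <= N%:R * d + M.+1%:R * \sum_(0 <= k < N) e k.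
Proof.
move=> MN e0 q1 qS.
have H k : (0 < k <= N)%N ->
    'C(k.-1, M)%:R * q k <= \sum_(0 <= l < k) 'C(l, M)%:R * (d + e l).
  elim: k => // -[|k] IH kN.
    by rewrite big_nat1 ler_wpM2l.
  rewrite big_nat_recr//=; have := IH (ltnW kN); move: IH => _ /= IH.
  apply: le_trans (lerD IH (ler_wpM2l _ (qS k.+1 kN))) => //.
  have -> : 'C(k, M)%:R = (1 - M%:R / k.+1%:R) * 'C(k.+1, M)%:R :> R.
    have [Mk|kM] := leqP M k.+1; last by rewrite !bin_small ?mulr0// ltnW.
    apply: (@mulfI _ k.+1%:R); first by rewrite pnatr_eq0.
    rewrite -natrM (mul_bin_down k.+1 M) natrM natrB//.
    have : k.+1%:R != 0 :> R by rewrite pnatr_eq0.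
    by move: (k.+1%:R) => K K0; field.
  by rewrite le_eqVlt; apply/orP; left; apply/eqP; ring.
have N0 : (0 < N)%N by exact: leq_ltn_trans MN.
have c0 : 0 < 'C(N.-1, M)%:R :> R by rewrite ltr0n bin_gt0 -ltnS prednK.
have {}H := H N _; rewrite N0 leqnn in H; have {H} := H isT.
under eq_bigr do rewrite mulrDr.
rewrite big_split/= -mulr_suml -natr_sum.
have -> : (\sum_(0 <= l < N) 'C(l, M) = 'C(N, M.+1))%N.
  by elim: N {MN e0 qS N0 c0} => [|n IHn]; rewrite ?big_nil// big_nat_recr//= IHn binS.
have : \sum_(0 <= l < N) 'C(l, M)%:R * e l <= 'C(N.-1, M)%:R * \sum_(0 <= l < N) e l.
  rewrite mulr_sumr big_nat [leRHS]big_nat; apply: ler_sum => l /andP[_ lN].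
  by rewrite ler_wpM2r ?e0// ler_nat leq_bin2l// -ltnS prednK.
set X := \sum_(0 <= l < N) _ * _; set Y := \sum_(_ <= _ < _) _ => XY qN.
rewrite -(ler_pM2l c0); have := ler_wpM2l (ler0n R M.+1) (le_trans qN (lerD (lexx _) XY)).
have : M.+1%:R * 'C(N, M.+1)%:R = N%:R * 'C(N.-1, M)%:R :> R.
  by rewrite -!natrM mul_bin_diag.
move=> E; rewrite mulrDr mulrA mulrA E; lra.
Qed.

Section RotationInvariantMean.
Context {R : realType} {m : nat} {W : Type}.
Variables (D : (W -> 'rV[R]_m -> R) -> Prop) (M : (W -> 'rV[R]_m -> R) -> R).
Hypothesis hM : rotation_invariant_mean D M.
Implicit Types (a b : W -> 'rV[R]_m -> R) (z : 'rV[R]_m) (t e : R).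

Lemma dom_scale c a : D a -> D (fun w z => c * a w z).
Proof. by move=> Da; exact: (dom_mul hM (dom_cst hM c) Da). Qed.

Lemma dom_opp a : D a -> D (fun w z => - a w z).
Proof.
move=> /(dom_scale (-1)); congr D.
by apply/funext => w; apply/funext => z; rewrite mulN1r.
Qed.

Lemma dom_sub a b : D a -> D b -> D (fun w z => a w z - b w z).
Proof. by move=> Da Db; exact: (dom_add hM Da (dom_opp Db)). Qed.

Lemma dom_sum (I : Type) (r : seq I) (P : pred I) (F : I -> W -> 'rV[R]_m -> R) :
  (forall i, P i -> D (F i)) -> D (fun w z => \sum_(i <- r | P i) F i w z).
Proof.
move=> DF; elim: r => [|i r IH].
  by under eq_fun do under eq_fun do rewrite big_nil; exact: (dom_cst hM).
under eq_fun do under eq_fun do rewrite big_cons.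
by case: (boolP (P i)) => // Pi; apply: (dom_add hM) => //; exact: DF.
Qed.

Lemma mean_opp a : D a -> M (fun w z => - a w z) = - M a.
Proof.
move=> Da; rewrite -mulN1r -(mean_scale hM)//; congr M.
by apply/funext => w; apply/funext => z; rewrite mulN1r.
Qed.

Lemma mean_sub a b : D a -> D b -> M (fun w z => a w z - b w z) = M a - M b.
Proof. by move=> Da Db; rewrite (mean_add hM) ?mean_opp//; exact: dom_opp. Qed.

Lemma mean_sum (I : Type) (r : seq I) (P : pred I) (F : I -> W -> 'rV[R]_m -> R) :
  (forall i, P i -> D (F i)) ->
  M (fun w z => \sum_(i <- r | P i) F i w z) = \sum_(i <- r | P i) M (F i).
Proof.
move=> DF; elim: r => [|i r IH].
  under eq_fun do under eq_fun do rewrite big_nil.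
  by rewrite (mean_cst hM) big_nil.
under eq_fun do under eq_fun do rewrite big_cons.
rewrite big_cons; case: (boolP (P i)) => // Pi.
by rewrite (mean_add hM) ?IH//; [exact: DF|exact: dom_sum].
Qed.

(** Over an empty [W] the constants 0 and 1 would be the same integrand. A point of [W] is what
    yields the signs of [G] and [U]. *)
Lemma mean_inhabited : inhabited W.
Proof.
apply: contrapT => nW; have /eqP := mean_cst hM 1; rewrite -[_ == _]negbK => /negP; apply.
rewrite (_ : (fun _ _ => 1) = (fun _ _ => 0)) ?(mean_cst hM) 1?eq_sym ?oner_neq0//.
by apply/funext => w; exfalso; apply: nW; constructor.
Qed.

Section SmoothedGradient.
Variables (f : 'rV[R]_m -> R) (x : W -> 'rV[R]_m) (y : 'rV[R]_m) (mu G U : R).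
Hypotheses (m0 : (0 < m)%N) (mu0 : 0 < mu)
  (hsub : forall w (z : 'rV[R]_m), enorm z <= 1 ->
     exists2 g, subdifferential f (x w + mu *: z) g & enorm g <= G)
  (hU : forall w, enorm (y - x w) <= U)
  (Dx : forall k, D (fun w _ => x w 0 k))
  (Df : forall t : R, `|t| <= 1 -> D (fun w z => f (x w + (t * mu) *: z))).

(** Radii are rescaled so that [mu] corresponds to [t = 1]. Second differences of [S] are the price
    of using increments of [f] instead of derivatives; [gap] bounds the mean of <g, y - x> for
    subgradients at distance [t * mu] from the base point. *)
Let h (t : R) (w : W) (z : 'rV[R]_m) := f (x w + (t * mu) *: z) - f (x w).
Let q t := M (fun w z => edot z (y - x w) * h t w z).
Let S t := M (h t).
Let gap := f y - M (fun w _ => f (x w)) + mu * G.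

Let Dfx : D (fun w _ => f (x w)).
Proof.
have := @Df 0; rewrite normr0 ler01 => /(_ isT); congr D.
by apply/funext => w; apply/funext => z; rewrite mul0r scale0r addr0.
Qed.

Let Dh t : `|t| <= 1 -> D (h t).
Proof. by move=> t1; exact: (dom_sub (Df t1) Dfx). Qed.

Let Dcoord k : D (fun w _ => (y - x w) 0 k).
Proof.
under eq_fun do under eq_fun do rewrite !mxE.
by apply: dom_sub; [exact: (dom_cst hM)|exact: Dx].
Qed.

Let Dedot : D (fun w z => edot z (y - x w)).
Proof. by apply: dom_sum => k _; apply: (dom_mul hM) => //; exact: (dom_coord hM). Qed.

Let G_ge0 : 0 <= G.
Proof.
have [w] := mean_inhabited.
by have [|g _ /(le_trans (enorm_ge0 _))] := @hsub w 0; rewrite ?enorm0.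
Qed.

Let U_ge0 : 0 <= U.
Proof.
have [w] := mean_inhabited.
exact: le_trans (enorm_ge0 _) (hU w).
Qed.

Let hsub' t w z : `|t| <= 1 -> enorm z = 1 ->
  exists2 g, subdifferential f (x w + (t * mu) *: z) g & enorm g <= G.
Proof.
move=> t1 z1; have [|g] := @hsub w (t *: z); first by rewrite enormZ z1 mulr1.
by rewrite scalerA mulrC; exists g.
Qed.

Let lipschitz_h t e w z : `|t| <= 1 -> `|e| <= 1 -> enorm z = 1 ->
  h t w z - h e w z <= `|t - e| * (mu * G).
Proof.
move=> t1 e1 z1; have [g fg gG] := hsub' w t1 z1.
have := subgradient_lipschitz (x w + (e * mu) *: z) fg.
rewrite opprD addrACA subrr add0r -scalerBl -mulrBl enormZ z1 mulr1 normrM (gtr0_norm mu0).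
rewrite /h opprD addrACA subrr addr0 => /le_trans; apply.
by rewrite mulrC -!mulrA !ler_wpM2l// ltW.
Qed.

Let h0 w z : h 0 w z = 0.
Proof. by rewrite /h mul0r scale0r addr0 subrr. Qed.

Let norm_h t w z : `|t| <= 1 -> enorm z = 1 -> `|h t w z| <= mu * G.
Proof.
move=> t1 z1; have tG : `|t| * (mu * G) <= mu * G by rewrite ler_piMl// mulr_ge0// ltW.
have z01 : `|0 : R| <= 1 by rewrite normr0.
have := lipschitz_h w t1 z01 z1; have := lipschitz_h w z01 t1 z1.
by rewrite !h0 !subr0 !sub0r normrN ler_norml => *; apply/andP; split; lra.
Qed.

Let Dedoth t : `|t| <= 1 -> D (fun w z => edot z (y - x w) * h t w z).
Proof. by move=> t1; apply: (dom_mul hM) => //; exact: Dh. Qed.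

(* The mean of [h t (z *m Q)] over plane rotations [Q] by a small angle gives
   the tangential derivative of [f]; the second differences it costs vanish in
   the mean by invariance, so no differentiability of [f] is used. *)
Lemma mean_radial_step t e : 0 < t -> 0 <= e -> e <= t -> t + e <= 1 ->
  q (t + e) - q t + e / t * (m%:R - 1) * q t <=
  e * mu * gap + U * (S (t + e) - 2 * S t + S (t - e)).
Proof.
move=> t0 e0 et te1.
have at1 : `|t| <= 1 by rewrite gtr0_norm//; lra.
have ate : `|t + e| <= 1 by rewrite ger0_norm//; lra.
have ate' : `|t - e| <= 1 by rewrite ger0_norm//; lra.
pose N := (\sum_(p : 'I_m * 'I_m | p.1 != p.2) 1 : R).
have N0 : 0 <= N by exact: sumr_ge0.
(* Two errors of order s^2, one from [1 - c] and one from [rotation_defect], are multiplied by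
   [k = e / (t * s)] and remain of order [s]. *)
apply: (@le_of_le_add_small _ _ _ (e / t * N * U * mu * G * (6 * t + 1))) => s s0 s1.
pose c := Num.sqrt (1 - s ^+ 2).
have ss : s ^+ 2 <= 1 by rewrite expr_le1// ltW.
have c2 : c ^+ 2 = 1 - s ^+ 2 by rewrite sqr_sqrtr// subr_ge0.
have cs : c ^+ 2 + s ^+ 2 = 1 by rewrite c2 subrK.
have csN : c ^+ 2 + (- s) ^+ 2 = 1 by rewrite sqrrN.
have c0 : 0 <= c by exact: sqrtr_ge0.
have c1 : c <= 1 by rewrite -(@ler_pXn2r _ 2)// ?nnegrE// c2 expr1n gerBl sqr_ge0.
have cs2 : 1 - c <= s ^+ 2 by nra.
pose Q (p : 'I_m * 'I_m) r := plane_rotation p.1 p.2 c r.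
pose T w z (p : 'I_m * 'I_m) := (y - x w) 0 p.2 * z 0 p.1 * (h t w (z *m Q p s) - h t w z).
(* With this factor the rotations contribute e mu (<g, u> - <z, u> <g, z>), whose second term
   cancels the radial contribution e mu <z, u> <g, z>. *)
pose k := e / (t * s).
have k0 : 0 <= k by rewrite divr_ge0// mulr_ge0// ltW.
have oQ p r : p.1 != p.2 -> c ^+ 2 + r ^+ 2 = 1 -> Q p r *m (Q p r)^T = 1%:M.
  exact: plane_rotation_orthogonal.
have Dht := Dh at1; have Dhp := Dh ate; have Dhm := Dh ate'.
have DhQ p r : p.1 != p.2 -> c ^+ 2 + r ^+ 2 = 1 -> D (fun w z => h t w (z *m Q p r)).
  by move=> p12 cr; exact: (dom_rot hM (oQ _ _ p12 cr) Dht).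
have oN : (- 1%:M) *m (- 1%:M)^T = 1%:M :> 'M[R]_m.
  by rewrite linearN/= trmx1 mulNmx mulmxN opprK mulmx1.
have DhN : D (fun w z => h t w (z *m - 1%:M)) by exact: (dom_rot hM oN Dht).
have DT p : p.1 != p.2 -> D (fun w z => T w z p).
  move=> p12; apply: (dom_mul hM); last by apply: dom_sub => //; exact: DhQ.
  by apply: (dom_mul hM) => //; exact: (dom_coord hM).
have DS : D (fun w z => \sum_(p | p.1 != p.2) T w z p) by exact: dom_sum.
have Dq := Dedoth.
(* invariance under the inverse rotation turns the increments of [h] into [q] *)
have LHS : s * (m%:R - 1) * q t - s ^+ 2 * (N * U * (mu * G))
    <= M (fun w z => \sum_(p | p.1 != p.2) T w z p).
  have TE p : p.1 != p.2 -> M (fun w z => T w z p) =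
      M (fun w z => (y - x w) 0 p.2 * ((c - 1) * z 0 p.1 + s * z 0 p.2) * h t w z).
    move=> p12; pose a w z := (y - x w) 0 p.2 * (z *m Q p (- s)) 0 p.1 * h t w z.
    have Da : D a.
      apply: (dom_mul hM) => //; apply: (dom_mul hM) => //.
      apply: (@dom_rot _ _ _ _ _ hM (fun w z => z 0 p.1)); [exact: oQ|exact: (dom_coord hM)].
    pose b w z := (y - x w) 0 p.2 * z 0 p.1 * h t w z.
    have Db : D b.
      by apply: (dom_mul hM) => //; apply: (dom_mul hM) => //; exact: (dom_coord hM).
    transitivity (M a - M b).
      rewrite -(mean_rot hM (oQ _ _ p12 cs) Da) -mean_sub//; last first.
        exact: (dom_rot hM (oQ _ _ p12 cs) Da).
      congr M; apply/funext => w; apply/funext => z.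
      by rewrite /a /b /T plane_rotationNK// mulrBr.
    rewrite -mean_sub//; congr M; apply/funext => w; apply/funext => z.
    by rewrite /a /b plane_rotationNl//; ring.
  rewrite mean_sum// (eq_bigr _ TE) -mean_sum; last first.
    move=> p _; apply: (dom_mul hM) => //; apply: (dom_mul hM) => //.
    by apply: (dom_add hM); apply: dom_scale; exact: (dom_coord hM).
  have -> : s * (m%:R - 1) * q t - s ^+ 2 * (N * U * (mu * G)) =
      M (fun w z => s * (m%:R - 1) * (edot z (y - x w) * h t w z)
                    - s ^+ 2 * (N * U * (mu * G))).
    rewrite mean_sub; [|by apply: dom_scale; exact: Dq|exact: (dom_cst hM)].
    by rewrite (mean_scale hM) ?(mean_cst hM)//; exact: Dq.
  apply: (mean_le hM).
  - by apply: dom_sub; [apply: dom_scale; exact: Dq|exact: (dom_cst hM)].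
  - apply: dom_sum => p _; apply: (dom_mul hM) => //; apply: (dom_mul hM) => //.
    by apply: (dom_add hM); apply: dom_scale; exact: (dom_coord hM).
  move=> w z z1; set u := y - x w; set H := h t w z.
  have sumE : \sum_(p : 'I_m * 'I_m | p.1 != p.2) u 0 p.2 * z 0 p.2
      = (m%:R - 1) * edot z u.
    rewrite (_ : \sum_(p | _) _ = \sum_i \sum_(j | i != j) u 0 j * z 0 j); last first.
      by rewrite pair_big_dep.
    rewrite (exchange_big_dep xpredT)//= mulr_sumr; apply: eq_bigr => j _.
    rewrite sumr_const (eq_card (B := predC1 j)) ?cardC1 ?card_ord//.
    have -> : m%:R - 1 = m.-1%:R :> R by rewrite -subn1 natrB.
    by rewrite mulr_natl mulrC.
  have E (p : 'I_m * 'I_m) : u 0 p.2 * ((c - 1) * z 0 p.1 + s * z 0 p.2) * H =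
      (c - 1) * (u 0 p.2 * (z 0 p.1 * H)) + s * (u 0 p.2 * z 0 p.2 * H) by ring.
  under eq_bigr do rewrite E.
  rewrite big_split/= -!mulr_sumr -mulr_suml sumE.
  have : `|\sum_(p | p.1 != p.2) u 0 p.2 * (z 0 p.1 * H)| <= N * (U * (mu * G)).
    rewrite /N mulr_suml (le_trans (ler_norm_sum _ _ _))//.
    apply: ler_sum => p _; rewrite mul1r !normrM.
    rewrite ler_pM ?mulr_ge0//; first by rewrite (le_trans (coord_le_enorm _ _))// hU.
    by rewrite -[mu * G]mul1r ler_pM// ?norm_h// -z1 coord_le_enorm.
  rewrite ler_norml => /andP[_]; set X := \sum_(p | _) _ => HX.
  have : (1 - c) * X <= s ^+ 2 * (N * (U * (mu * G))).
    apply: (@le_trans _ _ ((1 - c) * (N * (U * (mu * G))))).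
      by rewrite ler_wpM2l// subr_ge0.
    by rewrite ler_wpM2r// !mulr_ge0// ltW.
  lra.
pose a w z := edot z (y - x w) * h (t + e) w z - edot z (y - x w) * h t w z.
(* The odd part of [h t], of mean zero under the rotation [- 1%:M], replaces [h t]: the even part is
   nonnegative by convexity. *)
pose b1 w z := f y - f (x w) + mu * G - 2^-1 * (h t w z - h t w (z *m - 1%:M)).
pose b2 w z := h (t + e) w z - 2 * h t w z + h (t - e) w z.
pose d p w z := h t w (z *m Q p s) + h t w (z *m Q p (- s)) - 2 * h t w z.
pose b3 w z := \sum_(p | p.1 != p.2) d p w z.
pose K := N * U * (6 * (t * mu) * G * s ^+ 2).
have Da : D a by apply: dom_sub; exact: Dq.
have Dfy : D (fun w _ => f y - f (x w) + mu * G).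
  by apply: (dom_add hM); [apply: dom_sub => //|]; exact: (dom_cst hM).
have Db1 : D b1 by apply: dom_sub => //; apply: dom_scale; exact: dom_sub.
have Db2 : D b2 by apply: (dom_add hM) => //; apply: dom_sub => //; exact: dom_scale.
have Dd p : p.1 != p.2 -> D (d p).
  move=> p12; apply: dom_sub; last exact: dom_scale.
  by apply: (dom_add hM); exact: DhQ.
have Db3 : D b3 by exact: dom_sum.
have Ma : M a = q (t + e) - q t by exact: mean_sub (Dq _ ate) (Dq _ at1).
have Mb1 : M b1 = gap.
  rewrite (mean_sub Dfy (dom_scale 2^-1 (dom_sub Dht DhN))).
  rewrite (mean_scale hM _ (dom_sub Dht DhN)) (mean_sub Dht DhN).
  rewrite (mean_rot hM oN Dht) subrr mulr0 subr0.
  have Dy : D (fun _ _ => f y) := dom_cst hM (f y).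
  rewrite (mean_add hM (dom_sub Dy Dfx) (dom_cst hM (mu * G))) (mean_sub Dy Dfx).
  by rewrite !(mean_cst hM).
have Mb2 : M b2 = S (t + e) - 2 * S t + S (t - e).
  rewrite (mean_add hM (dom_sub Dhp (dom_scale 2 Dht)) Dhm).
  by rewrite (mean_sub Dhp (dom_scale 2 Dht)) (mean_scale hM _ Dht).
have Mb3 : M b3 = 0.
  rewrite (mean_sum _ Dd) big1// => p p12.
  have D1 := DhQ _ _ p12 cs; have D2 := DhQ _ _ p12 csN.
  rewrite (mean_sub (dom_add hM D1 D2) (dom_scale 2 Dht)) (mean_add hM D1 D2).
  rewrite (mean_scale hM _ Dht) (mean_rot hM (oQ _ _ p12 cs) Dht).
  by rewrite (mean_rot hM (oQ _ _ p12 csN) Dht); lra.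
pose aa w z := a w z + k * \sum_(p | p.1 != p.2) T w z p.
pose bb w z := e * mu * b1 w z + U * b2 w z + (k * U * b3 w z + k * K).
have Daa : D aa by apply: (dom_add hM) => //; exact: dom_scale.
have Z1 := dom_scale (e * mu) Db1; have Z2 := dom_scale U Db2.
have Z3 := dom_scale (k * U) Db3; have Z4 := dom_cst hM (k * K).
have Dbb : D bb := dom_add hM (dom_add hM Z1 Z2) (dom_add hM Z3 Z4).
have Maa : M aa = q (t + e) - q t + k * M (fun w z => \sum_(p | p.1 != p.2) T w z p).
  by rewrite (mean_add hM Da (dom_scale k DS)) Ma (mean_scale hM _ DS).
have Mbb : M bb = e * mu * gap + U * (S (t + e) - 2 * S t + S (t - e)) + k * K.
  rewrite (mean_add hM (dom_add hM Z1 Z2) (dom_add hM Z3 Z4)).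
  rewrite (mean_add hM Z1 Z2) (mean_add hM Z3 Z4) (mean_cst hM).
  rewrite (mean_scale hM _ Db1) (mean_scale hM _ Db2) (mean_scale hM _ Db3).
  by rewrite Mb1 Mb2 Mb3 mulr0 add0r.
have : M aa <= M bb.
  apply: (mean_le hM) => // w z z1; set u := y - x w.
  have [g fg gG] := hsub' w at1 z1.
  have tmu0 : 0 <= t * mu by rewrite mulr_ge0// ltW.
  have zu : `|edot z u| <= U.
    by rewrite (le_trans (norm_edot _ _))// z1 mul1r hU.
  have := radial_defect (mulr_ge0 e0 (ltW mu0)) zu fg.
  rewrite -mulrDl -mulrBl => R1.
  have R2 : \sum_(p | p.1 != p.2) T w z p <=
      t * mu * s * (edot g u - edot z u * edot g z) + (U * b3 w z + K).
    rewrite -sum_rotation_fields// /K /N !mulr_sumr !mulr_suml -!big_split/=.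
    apply: ler_sum => -[i j] /= ij; rewrite mul1r -mulrDr.
    have := rotation_defect ij cs c1 cs2 z1 tmu0 fg gG.
    set X := f (x w + _ *: (z *m plane_rotation i j c s)).
    set Y := f (x w + _ *: (z *m plane_rotation i j c (- s))).
    set Z := f (x w + _ *: z) => H.
    have uz : `|u 0 j * z 0 i| <= U.
      rewrite -[U]mulr1 normrM ler_pM// -?z1 ?coord_le_enorm//.
      by rewrite (le_trans (coord_le_enorm _ _))// hU.
    have {H} := ler_pM (normr_ge0 _) (normr_ge0 _) uz H.
    rewrite -normrM => /(le_trans (ler_norm _)).
    by rewrite /T /d /h /= -/u -/X -/Y -/Z; lra.
  (* Split [u] into y - (x + t mu z), handled by the subgradient inequality at [y], and t mu z,
     which costs at most mu G. *)
  have R3 : edot g u <= f y - f (x w) - h t w z + mu * G.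
    have := fg y; rewrite opprD addrA edotDr edotNr -/u edotZr /h.
    have : t * mu * edot g z <= mu * G.
      apply: (@le_trans _ _ (t * mu * G)).
        by rewrite ler_wpM2l// (le_trans (edot_le _ _))// z1 mulr1.
      by rewrite ler_wpM2r// ler_piMl ?(ltW mu0)//; lra.
    lra.
  have R4 : 0 <= h t w z + h t w (z *m - 1%:M).
    have [||g0 fg0 _] := @hsub' 0 w z; [by rewrite normr0|by []|].
    rewrite mul0r scale0r addr0 in fg0; rewrite /h mulmxN mulmx1 scalerN.
    have := fg0 (x w + (t * mu) *: z); have := fg0 (x w - (t * mu) *: z).
    rewrite ![x w + _ - x w]addrC !addKr edotNr; lra.
  have k3 : k * (t * mu * s) = e * mu by rewrite /k; field; rewrite !gt_eqF.
  have {}R2 := ler_wpM2l k0 R2.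
  have {}R3 := ler_wpM2l (mulr_ge0 e0 (ltW mu0)) R3.
  have {}R4 := mulr_ge0 (mulr_ge0 e0 (ltW mu0)) R4.
  rewrite /aa /bb; set A := \sum_(p | _) _ in R2 *; set B := b3 w z in R2 *.
  move: R2; rewrite mulrDr mulrA k3; move: R1 R3 R4.
  rewrite /a /b1 /b2 -/u; rewrite /h.
  lra.
rewrite Maa Mbb => H.
have : k * (s * (m%:R - 1) * q t - s ^+ 2 * (N * U * (mu * G))) <=
    k * M (fun w z => \sum_(p | p.1 != p.2) T w z p) by exact: ler_wpM2l.
have ks : k * s = e / t by rewrite /k; field; rewrite !gt_eqF.
have -> : k * (s * (m%:R - 1) * q t - s ^+ 2 * (N * U * (mu * G))) =
   (k * s) * (m%:R - 1) * q t - (k * s) * s * (N * U * (mu * G)) by ring.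
have kK : k * K = (k * s) * s * (N * U * 6 * (t * mu) * G) by rewrite /K; ring.
by move: H; rewrite kK ks; lra.
Qed.

Let second_difference_ge0 t e : 0 <= e -> e <= t -> t + e <= 1 ->
  0 <= S (t + e) - 2 * S t + S (t - e).
Proof.
move=> e0 et te1.
have Dt : D (h t) by apply: Dh; rewrite ger0_norm//; lra.
have Dp : D (h (t + e)) by apply: Dh; rewrite ger0_norm//; lra.
have Dm : D (h (t - e)) by apply: Dh; rewrite ger0_norm//; lra.
have D1 := dom_sub Dp (dom_scale 2 Dt).
rewrite -(mean_scale hM _ Dt) -(mean_sub Dp (dom_scale 2 Dt)) -(mean_add hM D1 Dm).
rewrite -[leLHS](mean_cst hM); apply: (mean_le hM) => //.
- exact: (dom_cst hM).
- exact: (dom_add hM).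
move=> w z z1; have [||g fg _] := @hsub' t w z; [by rewrite ger0_norm//; lra|by []|].
have := fg (x w + ((t + e) * mu) *: z); have := fg (x w + ((t - e) * mu) *: z).
have E r : x w + ((t + r) * mu) *: z - (x w + (t * mu) *: z) = (r * mu) *: z.
  by apply/rowP => i; rewrite !mxE; ring.
by rewrite !E !mulNr scaleNr edotNr /h; lra.
Qed.

(** The recursion is singular at [t = 0], so the first grid point is treated crudely: [q e] and
    [- (e * mu * gap)] are each at most [U * mu * G * e]. *)
Let first_step e : 0 <= e -> e <= 1 -> q e <= e * mu * gap + 2 * U * mu * G * e.
Proof.
move=> e0 e1; have ae : `|e| <= 1 by rewrite ger0_norm.
have zu w z : enorm z = 1 -> `|edot z (y - x w)| <= U.
  by move=> z1; rewrite (le_trans (norm_edot _ _))// z1 mul1r hU.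
have : q e <= U * (e * (mu * G)).
  rewrite -[leRHS](mean_cst hM); apply: (mean_le hM); [exact: Dedoth|exact: (dom_cst hM)|].
  move=> w z z1; apply: le_trans (ler_norm _) _; rewrite normrM ler_pM ?zu//.
  have z01 : `|0 : R| <= 1 by rewrite normr0.
  have := lipschitz_h w ae z01 z1; have := lipschitz_h w z01 ae z1.
  rewrite !h0 !subr0 !sub0r normrN (ger0_norm e0) ler_norml => *.
  by apply/andP; split; lra.
have : M (fun w _ => f (x w)) <= f y + G * U.
  rewrite -[leRHS](mean_cst hM); apply: (mean_le hM) => //; first exact: (dom_cst hM).
  move=> w z z1; have [||g fg gG] := @hsub' 0 w z; [by rewrite normr0|by []|].
  rewrite mul0r scale0r addr0 in fg; have := subgradient_lipschitz y fg.
  have : enorm g * enorm (x w - y) <= G * U by rewrite ler_pM ?enorm_ge0// enormBC.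
  lra.
move=> /(ler_wpM2l (mulr_ge0 e0 (ltW mu0))).
have : 0 <= e * mu * (mu * G) by rewrite !mulr_ge0// ltW.
rewrite /gap; lra.
Qed.

Let lipschitz_S t e : `|t| <= 1 -> `|e| <= 1 -> S t - S e <= `|t - e| * (mu * G).
Proof.
move=> t1 e1; rewrite -mean_sub; [|exact: Dh|exact: Dh].
rewrite -[leRHS](mean_cst hM); apply: (mean_le hM).
- by apply: dom_sub; exact: Dh.
- exact: (dom_cst hM).
- by move=> w z z1; exact: lipschitz_h.
Qed.

Lemma mean_gradient_le : m%:R * q 1 <= mu * gap.
Proof.
apply: (@le_of_le_add_small _ _ _ (m%:R * (4 * U * mu * G))) => s s0 s1.
(* Large enough for 1 / N to be at most [s], and above [m.-1] so that the last binomial weight is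
   positive. *)
pose N := (Num.truncn s^-1 + m).+1.
have N0R : 0 < N%:R :> R by rewrite ltr0n.
have Ns : N%:R^-1 <= s.
  rewrite invf_ple ?posrE//; apply/ltW/(lt_le_trans (truncnS_gt _)).
  by rewrite ler_nat ltnS leq_addr.
have mN : (m.-1 < N)%N by rewrite prednK// /N leqW// leq_addl.
pose d := N%:R^-1 * mu * gap.
pose e k := if k is k'.+1 then
   U * (S (k'.+2%:R / N%:R) - 2 * S (k'.+1%:R / N%:R) + S (k'%:R / N%:R))
  else 2 * U * mu * G / N%:R.
have kNE k : k.+1%:R / N%:R = k%:R / N%:R + N%:R^-1 :> R by rewrite -natr1 mulrDl mul1r.
have kNE' k : k%:R / N%:R = k.+1%:R / N%:R - N%:R^-1 :> R by rewrite kNE addrK.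
have kN k : (k < N)%N -> k%:R / N%:R + N%:R^-1 <= 1 :> R.
  by move=> kN; rewrite -kNE ler_pdivrMr// mul1r ler_nat.
have step k : (0 < k < N)%N ->
    q (k.+1%:R / N%:R) - q (k%:R / N%:R) + m.-1%:R / k%:R * q (k%:R / N%:R) <= d + e k.
  case: k => // k /kN kN1.
  have -> : m.-1%:R = m%:R - 1 :> R by rewrite -[m in RHS]prednK// -natr1 addrK.
  have -> : (m%:R - 1) / k.+1%:R = N%:R^-1 / (k.+1%:R / N%:R) * (m%:R - 1) :> R.
    have : k.+1%:R != 0 :> R by rewrite pnatr_eq0.
    have : N%:R != 0 :> R by rewrite pnatr_eq0.
    by move: (k.+1%:R) (N%:R) => a b a0 b0; field; rewrite a0.
  rewrite /e (kNE k.+1) (kNE' k) /d; apply: mean_radial_step => //.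
  - by rewrite divr_gt0// ltr0n.
  - by rewrite ler_peMl ?ler1n// invr_ge0 ltW.
have e_ge0 k : (k < N)%N -> 0 <= e k.
  case: k => [_|k /kN kN1]; rewrite /e; first by rewrite divr_ge0 ?ler0n// !mulr_ge0// ltW.
  rewrite mulr_ge0// (kNE k.+1) (kNE' k); apply: second_difference_ge0 => //.
  by rewrite ler_peMl ?ler1n// invr_ge0 ltW.
have N1 : N%:R^-1 <= 1 :> R by rewrite invf_le1// ler1n.
have q1 : q (1%N%:R / N%:R) <= d + e 0%N.
  rewrite mul1r; have iN0 : 0 <= N%:R^-1 :> R by rewrite invr_ge0 ltW.
  exact: first_step iN0 N1.
have := binomial_gronwall mN e_ge0 q1 step.
rewrite divff ?gt_eqF// prednK//.
have -> : N%:R * d = mu * gap by rewrite /d !mulrA divff ?mul1r// gt_eqF.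
move=> /le_trans; apply; rewrite lerD2l mulrCA ler_wpM2l ?ler0n//.
(* Only the increments of [S] next to the two ends of [0, 1] survive, each worth at most mu G / N.
   With [e 0] the total is 4 U mu G / N. *)
have sumE n : (n < N)%N -> \sum_(0 <= k < n.+1) e k = 2 * U * mu * G / N%:R
    + U * (S (n.+1%:R / N%:R) - S (n%:R / N%:R) - (S (1 / N%:R) - S 0)).
  elim: n => [_|n IH nN]; first by rewrite big_nat1 mul0r subrr mulr0 addr0.
  rewrite big_nat_recr//= IH 1?ltnW//; ring.
rewrite sumE// divff ?gt_eqF// (kNE' (Num.truncn s^-1 + m)%N) divff ?gt_eqF//.
have iN0 : 0 <= N%:R^-1 :> R by rewrite invr_ge0 ltW.
have a1 : `|1 : R| <= 1 by rewrite normr1.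
have aN : `|N%:R^-1 : R| <= 1 by rewrite ger0_norm.
have aN' : `|1 - N%:R^-1 : R| <= 1 by rewrite ger0_norm; lra.
have a0 : `|0 : R| <= 1 by rewrite normr0.
have := lipschitz_S a1 aN'; have := lipschitz_S a0 aN; rewrite mul1r.
rewrite sub0r normrN subKr (ger0_norm iN0) => S1 S2.
have := ler_wpM2l U_ge0 S1; have := ler_wpM2l U_ge0 S2.
have : 0 <= U * mu * G by rewrite !mulr_ge0// ltW.
move=> /ler_wpM2r /(_ _ _ Ns); lra.
Qed.

Lemma mean_gradient_estimate :
  M (fun w z => f (x w) - f y
       - m%:R / mu * (f (x w + mu *: z) - f (x w)) * edot z (x w - y)) <= mu * G.
Proof.
have n1 : `|1 : R| <= 1 by rewrite normr1.
have Dfy := dom_sub Dfx (dom_cst hM (f y)).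
have Dq := dom_scale (m%:R / mu) (Dedoth n1).
rewrite [X in M X](_ : _ = fun w z => f (x w) - f y
    + m%:R / mu * (edot z (y - x w) * h 1 w z)); last first.
  apply/funext => w; apply/funext => z; rewrite /h mul1r -[x w - y]opprB edotNr.
  ring.
rewrite (mean_add hM Dfy Dq) (mean_sub Dfx (dom_cst hM _)) (mean_cst hM).
rewrite (mean_scale hM _ (Dedoth n1)) -/(q 1).
have := mean_gradient_le; rewrite -(ler_pM2l (_ : 0 < mu^-1)) ?invr_gt0//.
rewrite !mulrA mulVf ?gt_eqF// mul1r [mu^-1 * _]mulrC /gap; lra.
Qed.

End SmoothedGradient.
End RotationInvariantMean.

(** * Measurability and independence *)

Section VectorMeasurability.
Context {R : realType} {m : nat} {d : measure_display} {T : measurableType d}.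
Variable X : T -> 'rV[R]_m.
Hypothesis mX : forall k, measurable_fun setT (fun w => X w 0 k).

(** Cubes with rational centres are countably many and every open set is a union of them; this
    reduces Borel measurability of a vector to that of its coordinates. *)
Let box (q : 'rV[rat]_m) (n : nat) : set 'rV[R]_m :=
  [set v | forall k, `|ratr (q 0 k) - v 0 k| < n.+1%:R^-1].

Let measurable_box q n : measurable (X @^-1` box q n).
Proof.
rewrite (_ : X @^-1` _ = \bigcap_(k in [set: 'I_m])
    ((fun w => X w 0 k) @^-1` ball (ratr (q 0 k) : R^o) n.+1%:R^-1)).
  by apply: fin_bigcap_measurable => // k _; rewrite -[X in measurable X]setTI;
    apply: mX => //; exact: measurable_ball.
by apply/seteqP; split=> w H k; [move=> _|]; exact: H.
Qed.

Lemma measurable_preimage_open (U : set 'rV[R]_m) : open U -> measurable (X @^-1` U).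
Proof.
move=> oU; pose F (p : 'rV[rat]_m * nat) :=
  if pselect (box p.1 p.2 `<=` U) then X @^-1` box p.1 p.2 else set0.
rewrite (_ : X @^-1` U = \bigcup_p F p).
  apply: countable_bigcupT_measurable => [|p]; first exact: countableP.
  by rewrite /F; case: pselect => ? /=; [exact: measurable_box|exact: measurable0].
apply/seteqP; split => [w /= Uw|w [p _]]; last first.
  by rewrite /F; case: pselect => [BU|?] /=; [exact: BU|].
have /nbhs_ballP[e /= e0 eU] : nbhs (X w) U by exact: open_nbhs_nbhs.
(* Two points of a cube lie within [2 * i] of each other through its centre, so [2 * i < e] keeps
   the cube inside the ball. *)
pose n := Num.truncn (2 / e); pose i : R := n.+1%:R^-1.
have i0 : 0 < i by rewrite invr_gt0 ltr0n.
have ie : 2 * i < e.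
  have := truncnS_gt (2 / e); rewrite ltr_pdivrMr// mulrC => H.
  by rewrite ltr_pdivrMr ?ltr0n.
have /choice[q qX] k : exists q : rat, `|ratr q - X w 0 k| < i.
  have /rat_in_itvoo[q] : X w 0 k - i < X w 0 k + i by lra.
  by rewrite in_itv/= => /andP[? ?]; exists q; rewrite ltr_norml; apply/andP; split; lra.
exists (\row_k q k, n) => //; rewrite /F /=.
have Bw : box (\row_k q k) n (X w) by move=> k; rewrite mxE.
case: pselect => [//|nBU] /=; case: nBU => v Bv; apply: eU; split => // l k.
have := Bw k; have := Bv k; rewrite -/i mxE => Bvk Bwk.
rewrite ord1 /ball/= (le_lt_trans (ler_distD (ratr (q k)) _ _))//.
by rewrite (distrC (X w 0 k)); lra.
Qed.

(** The superlevel sets of [g] are preimages under [X] of unions of open balls. [g] is a function on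
    [T] rather than of the vector [X w], so the criterion also fits an iterate that is tied to [X]
    only by the projection relation. *)
Lemma measurable_semicontinuous (g : T -> R) :
  (forall w a, a < g w -> exists2 e, 0 < e & forall w',
     (forall k, `|X w 0 k - X w' 0 k| < e) -> a < g w') ->
  measurable_fun setT g.
Proof.
move=> gX; apply: (measurability _ (RGenOInfty.measurableE R)) => _ [_ [a ->] <-].
rewrite setTI; pose I := [set p : T * R | 0 < p.2 /\ forall w',
  (forall k, `|X p.1 0 k - X w' 0 k| < p.2) -> a < g w'].
rewrite (_ : _ @^-1` _ = X @^-1` (\bigcup_(p in I) ball (X p.1) p.2)).
  apply: measurable_preimage_open; apply: bigcup_open => p [p0 _].
  exact: ball_open.
apply/seteqP; split => [w|w [p [p0 pI] [_ pw]]] /=; rewrite in_itv/= andbT.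
  by move=> /gX[e e0 ew]; exists (w, e) => //; exact: ballxx.
by apply: pI => k; exact: pw.
Qed.

(** A subgradient at [X w] bounds [f] from below around it, which is lower semicontinuity. The
    factor [m] in [r] converts closeness of coordinates into Euclidean distance. *)
Lemma measurable_subdifferentiable (f : 'rV[R]_m -> R) :
  (forall x, subdifferential f x !=set0) -> measurable_fun setT (f \o X).
Proof.
move=> sf; apply: measurable_semicontinuous => w a /= aw.
have [g fg] := sf (X w); pose r := (f (X w) - a) / (enorm g * m%:R + 1).
have c0 : 0 < enorm g * m%:R + 1 by rewrite ltr_wpDl// mulr_ge0 ?enorm_ge0.
have r0 : 0 < r by rewrite divr_gt0// subr_gt0.
have rE : r * (enorm g * m%:R + 1) = f (X w) - a by rewrite divfK// gt_eqF.
exists r => // w' ww'; have H := subgradient_lipschitz (X w') fg.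
have : enorm (X w - X w') <= m%:R * r.
  rewrite (le_trans (enorm_le_sum _))//.
  rewrite -[m in m%:R]card_ord mulr_natl -sumr_const; apply: ler_sum => k _.
  by rewrite !mxE ltW.
move=> /(ler_wpM2l (enorm_ge0 g)) H'; lra.
Qed.

Lemma measurable_edot (Y : T -> 'rV[R]_m) :
  (forall k, measurable_fun setT (fun w => Y w 0 k)) ->
  measurable_fun setT (fun w => edot (X w) (Y w)).
Proof. by move=> mY; apply: measurable_sum => k; exact: measurable_funM. Qed.

End VectorMeasurability.

Lemma measurable_coord (R : realType) m k :
  measurable_fun (setT : set (g_sigma_algebraType [set U : set 'rV[R]_m | open U]))
    (fun v => v 0 k : R).
Proof.
apply: (measurability _ (RGenOInfty.measurableE R)) => _ [_ [a ->] <-].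
rewrite setTI; apply: sub_sigma_algebra => /=.
by apply: open_comp => [v _|]; [exact: coord_continuous|exact: rray_open].
Qed.

Lemma measurable_vector (R : realType) m d (T : measurableType d) (X : T -> 'rV[R]_m) :
  (forall k, measurable_fun setT (fun w => X w 0 k)) ->
  measurable_fun setT
    (X : T -> g_sigma_algebraType [set U : set 'rV[R]_m | open U]).
Proof.
move=> mX; pose G := [set U : set 'rV[R]_m | open U].
apply: (@measurability _ _ T (g_sigma_algebraType G) setT X G erefl).
by move=> _ [U oU <-]; rewrite setTI; exact: measurable_preimage_open.
Qed.

Lemma borel_esphere (R : realType) m : borel_rV (esphere : set 'rV[R]_m).
Proof.
pose V := g_sigma_algebraType [set U : set 'rV[R]_m | open U].
rewrite (_ : esphere = (fun v : V => edot v v) @^-1` [set 1]).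
  have mdot : measurable_fun setT (fun v : V => edot v v).
    by apply: measurable_edot => k; exact: measurable_coord.
  have := mdot measurableT _ (measurable_set1 (1 : R)); rewrite setTI; exact.
apply/seteqP; split => v; rewrite /esphere/= /enorm.
  by move=> v1; rewrite -sqr_enorm /enorm v1 expr1n.
by move=> ->; rewrite sqrtr1.
Qed.

(** * Rotation invariance of a direction independent of the past *)

Section IndependentDirection.
Context {d : measure_display} {W : measurableType d} {R : realType} {m : nat}.
Variables (P : probability W R) (C : set (set W)) (Z : W -> 'rV[R]_m).
Hypotheses (mC : <<s C >> `<=` measurable) (hZ : uniform_on_sphere P Z)
  (indep : forall S B, <<s C >> S -> borel_rV B ->
     P (S `&` Z @^-1` B) = (P S * P (Z @^-1` B))%E).

Local Notation H := (g_sigma_algebraType C).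
Local Notation V := (g_sigma_algebraType [set U : set 'rV[R]_m | open U]).

Let S := Z @^-1` esphere.

Let mZ : measurable_fun setT (Z : W -> V).
Proof. by move=> _ B mB; rewrite setTI; case: hZ => + _ _; apply. Qed.

Let mid : measurable_fun setT (id : W -> H).
Proof. by move=> _ B mB; rewrite setTI; exact: mC. Qed.

Let m_id k : measurable_fun setT (fun v : V => v 0 k) := @measurable_coord R m k.

Let m_mulmx (Q : 'M[R]_m) : measurable_fun setT (fun v : V => v *m Q : V).
Proof.
apply: measurable_vector => k.
rewrite [X in measurable_fun _ X](_ : _ = fun v : V => \sum_j v 0 j * Q j k); last first.
  by apply/funext => v; rewrite mxE.
by apply: measurable_sum => j; apply: measurable_funM.
Qed.

Let borel_sphere : measurable (esphere : set V) := @borel_esphere R m.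

Let mS : measurable S.
Proof. by rewrite -[X in measurable X]setTI; exact: mZ. Qed.

Let PS : P S = 1%E. Proof. by case: hZ. Qed.

(** Measurability over [H] makes the first argument depend on the events generated by [C] alone.
    Boundedness is asked for unit vectors only, since the costs are controlled on [Omega];
    accordingly [direction_mean] integrates over [S]. *)
Definition direction_integrand (a : W -> 'rV[R]_m -> R) : Prop :=
  measurable_fun [set: H * V] (fun p => a p.1 p.2) /\
  exists K, forall w z, enorm z = 1 -> `|a w z| <= K.

Definition direction_mean (a : W -> 'rV[R]_m -> R) : R :=
  \int[P]_(w in S) a w (Z w).

Let mpair (Q : 'M[R]_m) : measurable_fun setT (fun w => (w, Z w *m Q) : H * V).
Proof.
apply: (@measurable_fun_pair _ _ _ W H V) => //.
exact: (measurableT_comp (m_mulmx Q) mZ).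
Qed.

Let integrable_direction a (Q : 'M[R]_m) : Q *m Q^T = 1%:M -> direction_integrand a ->
  P.-integrable S (EFin \o (fun w => a w (Z w *m Q))).
Proof.
move=> oQ [ma [K aK]]; apply: measurable_bounded_integrable => //.
- by rewrite (le_lt_trans (probability_le1 P mS))// ltry.
- exact: measurable_funTS (measurableT_comp ma (mpair Q)).
- exists `|K|; split; first by rewrite num_real.
  move=> r Kr w Sw; apply/ltW; apply: le_lt_trans Kr.
  by rewrite (le_trans (aK _ _ _) (ler_norm _))// enorm_orthogonal.
Qed.

(** The pairs (w, Z w) and (w, Z w Q) have the same law on [H * V]. Independence gives every
    rectangle a product of probabilities, the second factor is unchanged by [Q], and the rectangles
    form a generating pi-system. *)
Let rotation_invariance a (Q : 'M[R]_m) : Q *m Q^T = 1%:M -> direction_integrand a ->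
  \int[P]_(w in S) a w (Z w *m Q) = direction_mean a.
Proof.
move=> oQ Da; have ma := Da.1.
have o1 : 1%:M *m (1%:M)^T = 1%:M :> 'M[R]_m by rewrite mul1mx trmx1.
pose g (p : H * V) := (a p.1 p.2)%:E.
have mg : measurable_fun setT g by exact/measurable_EFinP.
pose D : set (H * V) := setT `*` esphere.
have mD : measurable D by exact: measurableX.
have DE (Q' : 'M[R]_m) : Q' *m Q'^T = 1%:M ->
    (fun w => (w, Z w *m Q') : H * V) @^-1` D = S.
  move=> oQ'; apply/seteqP; split => w; rewrite /S /D /=.
    by move=> [_]; rewrite /esphere /= enorm_orthogonal.
  by rewrite /esphere /= => w1; split => //; rewrite enorm_orthogonal.
have E (Q' : 'M[R]_m) (oQ' : Q' *m Q'^T = 1%:M) :=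
  @integral_pushforward _ _ W _ R _ (mpair Q') P D g mg.
rewrite /direction_mean /Rintegral; congr fine.
have EQ := E _ oQ; rewrite DE// in EQ.
have E1 := E _ o1; rewrite DE// in E1.
transitivity (\int[P]_(w in S) (g \o (fun w => (w, Z w *m 1%:M) : H * V)) w)%E; last first.
  by apply: eq_integral => w _; rewrite /= mulmx1.
rewrite -E1//; last exact: integrable_direction.
rewrite -EQ//; last exact: integrable_direction.
apply: eq_measure_integral => A mA _.
have borelE (Q' : 'M[R]_m) (S1 : set H) (S2 : set V) : Q' *m Q'^T = 1%:M ->
    measurable S1 -> measurable S2 ->
    pushforward P (fun w => (w, Z w *m Q') : H * V) (S1 `*` S2)
    = (P S1 * P (Z @^-1` S2))%E.
  move=> oQ' mS1 mS2; have mS2Q : measurable ((fun v : V => v *m Q' : V) @^-1` S2).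
    by rewrite -[X in measurable X]setTI; exact: m_mulmx.
  rewrite /pushforward.
  transitivity (P (S1 `&` Z @^-1` ((fun v : V => v *m Q' : V) @^-1` S2))); first by [].
  by rewrite indep//; congr (_ * _)%E; case: hZ => _ _; exact.
apply: (measure_unique [set A1 `*` A2 |
  A1 in (measurable : set (set H)) & A2 in (measurable : set (set V))] (fun=> setT)) => //.
- exact: measurable_prod_measurableType.
- move=> _ _ [A1 mA1 [A2 mA2 <-]] [B1 mB1 [B2 mB2 <-]]; rewrite -setXI.
  by exists (A1 `&` B1); [exact: measurableI|exists (A2 `&` B2) => //; exact: measurableI].
- by move=> _; exists setT => //; exists setT => //; rewrite setXTT.
- by rewrite bigcup_const.
- by move=> _ [A1 mA1 [A2 mA2 <-]]; rewrite [LHS]borelE// [RHS]borelE.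
- by move=> _; rewrite [ltLHS](_ : _ = 1%E) ?ltry//; exact: probability_setT.
Qed.

Lemma direction_mean_invariant : rotation_invariant_mean direction_integrand direction_mean.
Proof.
have o1 : 1%:M *m (1%:M)^T = 1%:M :> 'M[R]_m by rewrite mul1mx trmx1.
have int a : direction_integrand a -> P.-integrable S (EFin \o (fun w => a w (Z w))).
  move=> /(integrable_direction o1); congr (P.-integrable S _).
  by apply/funext => w /=; rewrite mulmx1.
split.
- by move=> c; split; [exact: measurable_cst|exists `|c| => *].
- move=> k; split; first exact: measurableT_comp (m_id k) measurable_snd.
  by exists 1 => w z <-; exact: coord_le_enorm.
- move=> a b [ma [Ka aK]] [mb [Kb bK]]; split; first exact: measurable_funD.
  by exists (Ka + Kb) => w z z1; rewrite (le_trans (ler_normD _ _))// lerD ?aK ?bK.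
- move=> a b [ma [Ka aK]] [mb [Kb bK]]; split; first exact: measurable_funM.
  by exists (Ka * Kb) => w z z1; rewrite normrM ler_pM ?aK ?bK.
- move=> a Q oQ [ma [K aK]]; split; last first.
    by exists K => w z z1; apply: aK; rewrite enorm_orthogonal.
  apply: (measurableT_comp ma (g := fun p : H * V => (p.1, p.2 *m Q) : H * V)).
  apply: measurable_fun_pair; first exact: measurable_fst.
  exact: measurableT_comp (m_mulmx Q) measurable_snd.
- move=> c; transitivity (c * fine (P S)); first exact: Rintegral_cst.
  by rewrite PS mulr1.
- by move=> a b /int ia /int ib; rewrite /direction_mean RintegralD.
- by move=> c a /int ia; rewrite /direction_mean RintegralZl.
- move=> a b /int ia /int ib ab; apply: le_Rintegral => // w Sw.
  exact: ab.
- exact: rotation_invariance.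
Qed.

End IndependentDirection.

(** * Independence of the current direction from the past *)

Section Past.
Context {d : measure_display} {W : measurableType d} {R : realType} {n m : nat}.
Variables (P : probability W R) (zeta : 'I_n -> nat -> W -> 'rV[R]_m).
Hypotheses (hindep : mutually_independent P (fun k : 'I_n * nat => zeta k.1 k.2))
  (hunif : forall i t, uniform_on_sphere P (zeta i t)).

(** The inequality is strict: iterates of time [t] are determined by earlier directions, and have to
    be independent of each direction of time [t]. *)
Definition past (t : nat) : set (set W) :=
  [set zeta k.1 k.2 @^-1` B | k in [set k | (k.2 < t)%N] & B in borel_rV].

Let mz k B : borel_rV B -> measurable (zeta k.1 k.2 @^-1` B).
Proof. by move=> bB; case: (hunif k.1 k.2) => + _ _; apply. Qed.

Lemma measurable_past t : <<s past t >> `<=` measurable.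
Proof.
apply: smallest_sub; first exact: sigma_algebra_measurable.
by move=> _ [k _ [B bB <-]]; exact: mz.
Qed.

Lemma past_monotone s t : (s <= t)%N -> <<s past s >> `<=` <<s past t >>.
Proof.
move=> st; apply: sub_sigma_algebra2 => _ [k ks [B bB <-]].
by exists k; [exact: leq_trans st|exists B].
Qed.

(** Finite intersections of generators of the past: a pi-system on which mutual independence applies
    directly. *)
Let cylinder (t : nat) : set (set W) := [set S | exists (J : {fset 'I_n * nat}) A,
  [/\ forall k, borel_rV (A k), forall k, k \in J -> (k.2 < t)%N &
      S = \bigcap_(k in [set` J]) (zeta k.1 k.2 @^-1` A k)]].

Let borelT : borel_rV (setT : set 'rV[R]_m).
Proof. exact: sub_sigma_algebra openT. Qed.

Let borelI (A B : set 'rV[R]_m) : borel_rV A -> borel_rV B -> borel_rV (A `&` B).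
Proof.
exact: (@measurableI _ (g_sigma_algebraType [set U : set 'rV[R]_m | open U])).
Qed.

Let cylinderI t : setI_closed (cylinder t).
Proof.
move=> _ _ [J [A [bA tJ ->]]] [J' [A' [bA' tJ' ->]]].
exists (J `|` J')%fset, (fun k => (if k \in J then A k else setT)
  `&` (if k \in J' then A' k else setT)); split.
- by move=> k; apply: borelI; case: ifP.
- by move=> k; rewrite in_fsetU => /orP[/tJ|/tJ'].
apply/seteqP; split => w /=.
  by move=> [JA J'A] k /= _; split; case: ifP => // kJ; [exact: JA|exact: J'A].
move=> H; split => k /= kJ; have := H k; rewrite /= in_fsetU kJ ?orbT => /(_ isT) [].
  by [].
by [].
Qed.

(** As functions of [S], both sides are finite measures; they agree on the cylinders, hence on the
    sigma-algebra these generate. *)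
Lemma past_independent t i S B : <<s past t >> S -> borel_rV B ->
  P (S `&` zeta i t @^-1` B) = (P S * P (zeta i t @^-1` B))%E.
Proof.
move=> pS bB; set E := zeta i t @^-1` B.
have mE : measurable E by exact: (mz (i, t)).
have PE0 : 0 <= fine (P E) by exact: fine_ge0.
have PEE : (fine (P E))%:E = P E by rewrite fineK// fin_num_measure.
have cyl_measurable : cylinder t `<=` measurable.
  move=> _ [J [A [bA _ ->]]]; apply: fin_bigcap_measurable; first exact: finite_fset.
  by move=> k _; exact: mz.
have {}pS : <<s cylinder t >> S.
  apply: smallest_sub pS; first exact: smallest_sigma_algebra.
  move=> _ [k kt [A bA <-]]; apply: sub_sigma_algebra.
  exists [fset k]%fset, (fun=> A); split => //.
    by move=> k'; rewrite in_fset1 => /eqP ->.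
  apply/seteqP; split => w /=; last by apply; rewrite /= in_fset1.
  by move=> Aw k' /=; rewrite in_fset1 => /eqP ->.
transitivity (mscale (NngNum PE0) P S); last by rewrite muleC -[in RHS]PEE.
rewrite -[LHS]/(mrestr P mE S).
apply: (g_sigma_algebra_measure_unique (cylinder t) _ (fun=> setT)) pS => //.
- move=> _; exists fset0, (fun=> setT); split => //.
  by apply/seteqP; split => w //= _ k.
- by rewrite bigcup_const.
- move=> _ [J [A [bA tJ ->]]]; rewrite -[RHS]/((fine (P E))%:E * P _)%E PEE.
  rewrite -[LHS]/(P (_ `&` E)).
  (* All times in [J] are before [t], so [(i, t)] is a new index and [E] is one more factor of the
     same product. *)
  pose A' k := if k == (i, t) then B else A k.
  have itJ : (i, t) \notin J by apply/negP => /tJ /=; rewrite ltnn.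
  have A'J k : k \in J -> A' k = A k.
    by move=> kJ; rewrite /A' ifN//; apply: contraNneq itJ => <-.
  have bA' k : borel_rV (A' k) by rewrite /A'; case: ifP.
  have := hindep ((i, t) |` J)%fset bA'.
  rewrite big_fsetU1//= {2}/A' eqxx => H.
  have -> : (\bigcap_(k in [set` J]) (zeta k.1 k.2 @^-1` A k)) `&` E =
      \bigcap_(k in [set` ((i, t) |` J)%fset]) (zeta k.1 k.2 @^-1` A' k).
    apply/seteqP; split => w /=.
      move=> [Aw Ew] k /=; rewrite in_fset1U => /orP[/eqP ->|kJ].
        by rewrite /A' eqxx.
      by rewrite A'J//; exact: Aw.
    move=> H'; split.
      by move=> k /= kJ; have := H' k; rewrite /= in_fset1U kJ orbT A'J//; exact.
    by have := H' (i, t); rewrite /= in_fset1U eqxx /A' eqxx; exact.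
  rewrite H; congr (_ * _)%E; rewrite (hindep J bA) big_seq [RHS]big_seq.
  by apply: eq_bigr => k kJ; rewrite A'J.
- by move=> _; rewrite -[ltLHS]/(P (setT `&` E)) setTI -PEE ltry.
Qed.

End Past.

(** * Consensus and descent *)

Section PushSum.
Context {R : realType} {n : nat} (E : nat -> rel 'I_n) (A : nat -> 'M[R]_n).
Hypotheses (hEA : weighted_digraphs E A) (hG : network_assumption E A).
Variables (C lambda theta : R).
Hypothesis hconst : mixing_constants A C lambda theta.

Lemma weight_ge0 t i j : 0 <= A t i j.
Proof.
case: (boolP (E t j i)) => [/(weight_gt0 hEA)/ltW//|/(weight_eq0 hEA) ->//].
Qed.

Lemma sum_weights t j : \sum_i A t i j = 1.
Proof.
have /matrixP /(_ j 0) := column_stochastic hG t; rewrite !mxE => <-.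
by apply: eq_bigr => i _; rewrite !mxE mulr1.
Qed.

Lemma theta_gt0 : 0 < theta. Proof. by case: hconst. Qed.

Lemma phi_ge t i : theta^-1 <= phi A t i 0. Proof. by case: hconst. Qed.

Lemma phi_gt0 t i : 0 < phi A t i 0.
Proof. by apply: lt_le_trans (phi_ge t i); rewrite invr_gt0 theta_gt0. Qed.

Lemma inv_phi_le t i : (phi A t i 0)^-1 <= theta.
Proof. by rewrite invf_ple ?posrE ?phi_gt0 ?theta_gt0 ?phi_ge. Qed.

Lemma theta_ge1 (i : 'I_n) : 1 <= theta.
Proof. by have := inv_phi_le 0 i; rewrite /phi !mxE invr1. Qed.

Lemma sum_phi t : \sum_i phi A t i 0 = n%:R.
Proof.
elim: t => [|t IH].
  by under eq_bigr do rewrite mxE; rewrite sumr_const card_ord.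
under eq_bigr do rewrite mxE; rewrite exchange_big -IH.
by apply: eq_bigr => j _; rewrite -mulr_suml sum_weights mul1r.
Qed.

Lemma bmx_ge0 t i j : 0 <= bmx A t i j.
Proof. by rewrite mxE divr_ge0 ?mulr_ge0 ?weight_ge0 ?ltW ?phi_gt0. Qed.

Lemma sum_bmx t i : \sum_j bmx A t i j = 1.
Proof.
under eq_bigr do rewrite mxE; rewrite -mulr_suml.
rewrite (_ : \sum_j _ = phi A t.+1 i 0) ?divff ?gt_eqF ?phi_gt0//.
by rewrite [RHS]mxE.
Qed.

Lemma sum_phi_bmx t j : \sum_i phi A t.+1 i 0 * bmx A t i j = phi A t j 0.
Proof.
rewrite -[RHS]mul1r -(sum_weights t j) mulr_suml; apply: eq_bigr => i _.
by rewrite [bmx _ _ _ _]mxE mulrC divfK// gt_eqF// phi_gt0.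
Qed.

Section Consensus.
Context {m : nat} (X : nat -> 'I_n -> 'rV[R]_m) (eps : nat -> R).

Let V t i := \sum_j bmx A t i j *: X t j.
Let e t i := X t.+1 i - V t i.
Hypothesis e_le : forall t i, enorm (e t i) <= eps t.

Lemma bprodSr t l i j : (l <= t)%N ->
  bprod A l (t - l).+1 i j = \sum_a bmx A t i a * bprod A l (t - l) a j.
Proof. by move=> lt; rewrite /= mxE subnKC. Qed.

Lemma combined_expansion t i :
  (forall a, X t a = \sum_j bprod A 0 t a j *: X 0%N j
     + \sum_(0 <= l < t) \sum_j bprod A l.+1 (t - l.+1) a j *: e l j) ->
  V t i = \sum_j bprod A 0 t.+1 i j *: X 0%N j
     + \sum_(0 <= l < t) \sum_j bprod A l.+1 (t - l) i j *: e l j.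
Proof.
move=> XE; rewrite /V; under eq_bigr do rewrite XE scalerDr.
rewrite big_split/=; congr (_ + _).
  under eq_bigr do rewrite scaler_sumr.
  rewrite exchange_big/=; apply: eq_bigr => j _.
  have := @bprodSr t 0 i j (leq0n _); rewrite subn0 => ->.
  by rewrite scaler_suml; apply: eq_bigr => a _; rewrite scalerA.
under eq_bigr do rewrite scaler_sumr.
rewrite exchange_big/= big_nat [RHS]big_nat; apply: eq_bigr => l /= lt.
under eq_bigr do rewrite scaler_sumr.
rewrite exchange_big/=; apply: eq_bigr => j _.
rewrite -(subnSK lt) bprodSr// scaler_suml.
by apply: eq_bigr => a _; rewrite scalerA.
Qed.

(** The recursion X_{t+1} = B_t X_t + e_t unrolled. The perturbation [e l] enters at time [l.+1],
    where its product of matrices starts. *)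
Lemma expansion t i : X t i = \sum_j bprod A 0 t i j *: X 0%N j
     + \sum_(0 <= l < t) \sum_j bprod A l.+1 (t - l.+1) i j *: e l j.
Proof.
have delta (F : 'I_n -> 'rV[R]_m) k : \sum_j (1%:M : 'M[R]_n) k j *: F j = F k.
  rewrite (bigD1 k)//= mxE eqxx scale1r big1 ?addr0// => j jk.
  by rewrite mxE eq_sym (negbTE jk) scale0r.
elim: t i => [|t IH] i; first by rewrite big_nil addr0 delta.
rewrite -[LHS](subrK (V t i)) -/(e t i) addrC combined_expansion// -addrA.
by rewrite big_nat_recr//= subnn delta.
Qed.

(** The consensus error up to the factor [C]. Its one-step recursion lets the sum over time be
    bounded by telescoping, without exchanging a double sum. *)
Definition deviation (s0 : R) t : R :=
  lambda ^+ t * s0 + \sum_(0 <= l < t) lambda ^+ (t - l.+1) * (n%:R * eps l).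

Lemma deviationS s0 t : deviation s0 t.+1 = lambda * deviation s0 t + n%:R * eps t.
Proof.
rewrite /deviation big_nat_recr//= subnn expr0 mul1r mulrDr mulrA -exprS.
rewrite addrA mulr_sumr; congr (_ + _ + _).
rewrite big_nat [RHS]big_nat; apply: eq_bigr => l /= lt.
by rewrite [RHS]mulrA -exprS subSS subnSK.
Qed.

Lemma sum_deviation s0 N :
  (1 - lambda) * \sum_(0 <= t < N) deviation s0 t + deviation s0 N =
  s0 + n%:R * \sum_(0 <= t < N) eps t.
Proof.
elim: N => [|N IH]; first by rewrite /deviation !big_nil expr0; ring.
by rewrite !big_nat_recr//= deviationS; move: IH; lra.
Qed.

Let s0 := \sum_i enorm (X 0%N i).

(** [c] is the expansion with every product of matrices replaced by its limiting row, so it is the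
    same for all nodes. The mixtures [V] have passed through one more matrix and gain a factor
    [lambda]. *)
Lemma consensus t : exists c, forall i,
  enorm (X t i - c) <= C * deviation s0 t /\
  enorm (V t i - c) <= lambda * (C * deviation s0 t).
Proof.
have [C0 /andP[l0 l1] _ [p [_ _ _ mix]] _] := hconst.
have mixl l k i j : `|bprod A l k i j - p l 0 j| <= C * lambda ^+ k.
  by have := mix (l + k)%N l i j (leq_addr _ _); rewrite addKn.
exists (\sum_j p 0%N 0 j *: X 0%N j + \sum_(0 <= l < t) \sum_j p l.+1 0 j *: e l j) => i.
(* Serves both claims, with [k = 0] for [X t] and [k = 1] for [V t]; [h l] is the length of the
   product acting on [e l]. *)
have step k (h : nat -> nat) : (forall l, (l < t)%N -> h l = k + (t - l.+1))%N ->
  enorm (\sum_j bprod A 0 (k + t) i j *: X 0%N j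
     + \sum_(0 <= l < t) \sum_j bprod A l.+1 (h l) i j *: e l j -
    (\sum_j p 0%N 0 j *: X 0%N j + \sum_(0 <= l < t) \sum_j p l.+1 0 j *: e l j))
  <= lambda ^+ k * (C * deviation s0 t).
  move=> hE; rewrite opprD addrACA -!sumrB (le_trans (enormD _ _))//.
  rewrite /deviation !mulrDr lerD//.
    rewrite (le_trans (enorm_sum _ _))// /s0 !mulr_sumr ler_sum// => j _.
    rewrite -scalerBl enormZ !mulrA ler_wpM2r ?enorm_ge0//.
    by rewrite mulrAC -exprD mulrC mixl.
  rewrite (le_trans (enorm_sum _ _))// !mulr_sumr big_nat [leRHS]big_nat.
  apply: ler_sum => l /= lt; rewrite -sumrB (le_trans (enorm_sum _ _))//.
  have -> : lambda ^+ k * (C * (lambda ^+ (t - l.+1) * (n%:R * eps l)))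
      = \sum_(j < n) (C * lambda ^+ h l) * eps l.
    by rewrite sumr_const card_ord hE// exprD -mulr_natl; ring.
  apply: ler_sum => j _; rewrite -scalerBl enormZ ler_pM ?enorm_ge0//.
split.
  have := step 0%N (fun l => (t - l.+1)%N) (fun _ _ => erefl).
  by rewrite expansion expr0 mul1r.
rewrite combined_expansion; last by move=> a; exact: expansion.
have := step 1%N (fun l => (t - l)%N); rewrite expr1 add1n; apply.
by move=> l lt; rewrite add1n subnSK.
Qed.

Lemma combined_distance t i : enorm (V t i - X t i) <= (1 + lambda) * C * deviation s0 t.
Proof.
have [c H] := consensus t; have [H1 H2] := H i.
rewrite (_ : V t i - X t i = (V t i - c) - (X t i - c)); last first.
  by apply/rowP => k; rewrite !mxE; ring.
by rewrite (le_trans (enormB _ _))//; lra.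
Qed.

Lemma node_distance t i j : enorm (X t i - X t j) <= 2 * C * deviation s0 t.
Proof.
have [c H] := consensus t; have [H1 _] := H i; have [H2 _] := H j.
rewrite (_ : X t i - X t j = (X t i - c) - (X t j - c)); last first.
  by apply/rowP => k; rewrite !mxE; ring.
by rewrite (le_trans (enormB _ _))//; lra.
Qed.

Lemma sum_deviation_le N : (forall t, 0 <= eps t) ->
  \sum_(0 <= t < N) deviation s0 t <= (s0 + n%:R * \sum_(0 <= t < N) eps t) / (1 - lambda).
Proof.
move=> eps0; have [_ /andP[l0 l1] _ _ _] := hconst.
rewrite ler_pdivlMr ?subr_gt0// -sum_deviation mulrC lerDl /deviation addr_ge0//.
  by rewrite mulr_ge0 ?exprn_ge0 ?(ltW l0)// sumr_ge0// => i _; exact: enorm_ge0.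
by apply: sumr_ge0 => l _; rewrite !mulr_ge0 ?exprn_ge0 ?(ltW l0)// ler0n.
Qed.

End Consensus.
End PushSum.

(** In the regret, [a t] and [b t] are the potentials before and after a step, both relative to the
    comparator of time [t], and [e t] is the cost of moving the comparator. As [c] increases and [a]
    stays below [K], all increments of [c] add up to at most [c N]. *)
Lemma abel_telescope (R : realDomainType) (c a b e : nat -> R) (K : R) N :
  (forall t, 0 <= c t) -> (forall t, c t <= c t.+1) ->
  (forall t, 0 <= a t) -> (forall t, a t <= K) -> (forall t, 0 <= e t) ->
  (forall t, a t.+1 <= b t + e t) ->
  \sum_(0 <= t < N.+1) c t * (a t - b t) <= c N * (K + \sum_(0 <= t < N.+1) e t).
Proof.
move=> c0 cS a0 aK e0 ab.
(* The boundary term must be kept for the induction to close. *)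
suff : \sum_(0 <= t < N.+1) c t * (a t - b t) + c N * a N.+1 <=
    c N * (K + \sum_(0 <= t < N.+1) e t).
  by have := mulr_ge0 (c0 N) (a0 N.+1); lra.
elim: N => [|N IH].
  rewrite !big_nat1 -mulrDr ler_wpM2l//; have := ab 0%N; have := aK 0%N; lra.
rewrite big_nat_recr//= [in leRHS]big_nat_recr//=.
set s := \sum_(_ <= _ < _) e _ in IH *; set u := \sum_(_ <= _ < _) _ in IH *.
have s0 : 0 <= s by exact: sumr_ge0.
have := ler_wpM2l (c0 N.+1) (ab N.+1).
have : (c N.+1 - c N) * a N.+1 <= (c N.+1 - c N) * (K + s).
  by rewrite ler_wpM2l ?subr_ge0//; have := aK N.+1; lra.
lra.
Qed.

(** For consecutive square roots a < b, 1 / b <= 2 (b - a) follows from (b - a)^2 >= 0 and b^2 = a^2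
    + 1. *)
Lemma sum_invsqrt_le (R : rcfType) N :
  \sum_(0 <= t < N) (Num.sqrt t.+1%:R)^-1 <= 2 * Num.sqrt N%:R :> R.
Proof.
elim: N => [|N IH]; first by rewrite big_nil sqrtr0 mulr0.
rewrite big_nat_recr//=; apply: le_trans (lerD IH (lexx _)) _.
set a := Num.sqrt N%:R; set b := Num.sqrt N.+1%:R.
have a0 : 0 <= a by exact: sqrtr_ge0.
have b0 : 0 < b by rewrite sqrtr_gt0 ltr0n.
have a2 : a ^+ 2 = N%:R by rewrite sqr_sqrtr// ler0n.
have b2 : b ^+ 2 = N%:R + 1 by rewrite sqr_sqrtr ?natr1// ler0n.
rewrite -(ler_pM2r b0) mulrDl mulVf ?gt_eqF//; have := sqr_ge0 (b - a); nra.
Qed.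

(** * One projected step *)

Section Descent.
Context {R : realType} {n m : nat} (E : nat -> rel 'I_n) (A : nat -> 'M[R]_n).
Hypotheses (hEA : weighted_digraphs E A) (hG : network_assumption E A).
Variables (C lambda theta : R) (hconst : mixing_constants A C lambda theta).
Variables (S : set 'rV[R]_m) (t : nat) (X X' g : 'I_n -> 'rV[R]_m) (al K : R).
Hypotheses (cS : convex_set S) (al0 : 0 <= al) (gK : forall i, enorm (g i) <= K).

Let V i := \sum_j bmx A t i j *: X j.
Hypothesis pX' : forall i, is_proj S (V i - (al / phi A t.+1 i 0) *: g i) (X' i).

Let phi0 i : 0 < phi A t.+1 i 0 := phi_gt0 hconst t.+1 i.

Lemma lyapunov_step y : S y ->
  \sum_i phi A t.+1 i 0 * enorm (X' i - y) ^+ 2 <=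
  \sum_i phi A t i 0 * enorm (X i - y) ^+ 2
  - 2 * al * \sum_i edot (g i) (V i - y) + al ^+ 2 * (n%:R * (theta * K ^+ 2)).
Proof.
move=> Sy.
have VX : \sum_i phi A t.+1 i 0 * enorm (V i - y) ^+ 2 <=
    \sum_i phi A t i 0 * enorm (X i - y) ^+ 2.
  apply: (@le_trans _ _ (\sum_i phi A t.+1 i 0 * \sum_j bmx A t i j * enorm (X j - y) ^+ 2)).
    apply: ler_sum => i _; rewrite ler_wpM2l ?(ltW (phi0 i))//.
    apply: (@sqr_enorm_convex _ _ _ (bmx A t i)) => [j|].
      exact: (bmx_ge0 hEA hconst).
    exact: (sum_bmx hconst).
  under eq_bigr do rewrite mulr_sumr; rewrite exchange_big/= le_eqVlt.
  apply/orP; left; apply/eqP; apply: eq_bigr => j _.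
  rewrite -(sum_phi_bmx hG hconst) mulr_suml.
  by apply: eq_bigr => i _; rewrite mulrA.
have gg i : enorm (g i) ^+ 2 <= K ^+ 2.
  by rewrite ler_sqr ?nnegrE ?enorm_ge0// (le_trans (enorm_ge0 (g i))).
have step i : phi A t.+1 i 0 * enorm (X' i - y) ^+ 2 <=
    phi A t.+1 i 0 * enorm (V i - y) ^+ 2 - 2 * al * edot (g i) (V i - y)
    + al ^+ 2 * (theta * K ^+ 2).
  have := ler_pM (_ : 0 <= (phi A t.+1 i 0)^-1) (sqr_ge0 _) (inv_phi_le hconst t.+1 i) (gg i).
  rewrite invr_ge0 (ltW (phi0 i)) => /(_ isT) H.
  have : enorm (X' i - y) ^+ 2 <= enorm (V i - y - (al / phi A t.+1 i 0) *: g i) ^+ 2.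
    by rewrite ler_sqr ?nnegrE ?enorm_ge0// addrAC; exact: proj_dist cS (pX' i) Sy.
  move=> /(ler_wpM2l (ltW (phi0 i))) /le_trans; apply.
  rewrite (sqr_enormB (V i - y)) edotZr enormZ exprMn real_normK ?num_real// edotC.
  have pn0 : phi A t.+1 i 0 != 0 by rewrite gt_eqF.
  move: H => /(ler_wpM2l (sqr_ge0 al)).
  move: (phi A t.+1 i 0) pn0 => p pn0; set ev := edot _ _.
  set vv := enorm _ ^+ 2; set gi := enorm _ ^+ 2.
  have -> : p * (vv - 2 * (al / p * ev) + (al / p) ^+ 2 * gi) =
    p * vv - 2 * al * ev + al ^+ 2 * (p^-1 * gi) by field.
  lra.
apply: le_trans (ler_sum _ (fun i _ => step i)) _.
rewrite big_split sumrB sumr_const card_ord -[X in _ + X <= _]mulr_natl -mulr_sumr.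
move: VX; set u := \sum_i _; set v := \sum_i _; lra.
Qed.

(** The mixture is its own projection, so nonexpansiveness leaves only the length of the step. *)
Lemma displacement i : S (V i) -> enorm (X' i - V i) <= al * theta * K.
Proof.
move=> SV; apply: le_trans (proj_dist cS (pX' i) SV) _.
rewrite addrAC subrr add0r enormN enormZ ger0_norm ?divr_ge0 ?(ltW (phi0 i))//.
rewrite -!mulrA ler_wpM2l// ler_pM ?invr_ge0 ?(ltW (phi0 i)) ?enorm_ge0//.
exact: (inv_phi_le hconst).
Qed.

End Descent.

(** * Lipschitz costs and feasible perturbations *)

Section Feasibility.
Context {R : realType} {n m : nat} (Omega : set 'rV[R]_m) (f : 'I_n -> nat -> 'rV[R]_m -> R).
Variables (r Rb G : R).
Hypotheses (hf : forall i t, convex_function setT (f i t))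
  (hC : cost_assumption Omega f r Rb G).

Lemma cost_lipschitz i t x y : Omega x -> f i t x - f i t y <= G * enorm (x - y).
Proof.
move=> Ox; have [g fg] := subdifferential_nonempty x (hf i t).
apply: le_trans (subgradient_lipschitz y fg) _.
by rewrite ler_wpM2r ?enorm_ge0//; exact: (subgradient_bound hC Ox).
Qed.

(** With x = (1 - xi) x', the shifted point is (1 - xi) x' + xi (r v), a convex combination of
    points of [Omega]. The choice mu = r xi thus keeps the perturbed points where subgradients are
    bounded. *)
Lemma interior_shift xi e x v : 0 <= xi -> xi <= 1 -> e = r * xi ->
  dilate (1 - xi) Omega x -> enorm v <= 1 -> Omega (x + e *: v).
Proof.
move=> xi0 xi1 eE [x' Ox' <-] v1; have r0 := inner_radius_gt0 hC.
have Orv : Omega (r *: v).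
  by apply: (inner_ball hC); rewrite /eball/= enormZ gtr0_norm// ger_pMr.
have := convex_setP (constraint_convex hC) xi0 xi1 Orv Ox'.
by rewrite eE scalerA addrC [xi * r]mulrC.
Qed.

Lemma dilate_sub xi x : 0 <= xi -> xi <= 1 -> dilate (1 - xi) Omega x -> Omega x.
Proof.
move=> xi0 xi1 Sx; have := interior_shift xi0 xi1 erefl Sx (_ : enorm 0 <= 1).
by rewrite scaler0 addr0 enorm0; exact.
Qed.

End Feasibility.

(** * Regret along one outcome *)

Section PathwiseRegret.
Context {R : realType} {n m : nat} (E : nat -> rel 'I_n) (A : nat -> 'M[R]_n).
Hypotheses (hEA : weighted_digraphs E A) (hG : network_assumption E A).
Variables (C lambda theta : R) (hconst : mixing_constants A C lambda theta).
Variables (Omega : set 'rV[R]_m) (f : 'I_n -> nat -> 'rV[R]_m -> R).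
Variables (r Rb G : R) (xstar : nat -> 'rV[R]_m) (T : nat) (xi : R) (alpha : nat -> R).
Hypotheses (hf : forall i t, convex_function setT (f i t))
  (hC : cost_assumption Omega f r Rb G) (hstar : forall t, Omega (xstar t))
  (m0 : (0 < m)%N) (xi0 : 0 <= xi) (xi1 : xi <= 1)
  (halpha : forall t, alpha t = 1 / (m%:R * Num.sqrt t.+1%:R)).
Variables (X g : nat -> 'I_n -> 'rV[R]_m).

Let S := dilate (1 - xi) Omega.
Let V t i := \sum_j bmx A t i j *: X t j.
Let y t := (1 - xi) *: xstar t.

Hypotheses (X0 : forall i, S (X 0%N i))
  (XS : forall t i, is_proj S (V t i - (alpha t / phi A t.+1 i 0) *: g t i) (X t.+1 i))
  (gK : forall t i, enorm (g t i) <= m%:R * G).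

Let cS : convex_set S. Proof. exact/convex_dilate/(constraint_convex hC). Qed.
Let SO x : S x -> Omega x. Proof. exact: dilate_sub hC _ _ _ _. Qed.
Let SX t i : S (X t i). Proof. by case: t => [|t]; [exact: X0|case: (XS t i)]. Qed.
Let SV t i : S (V t i).
Proof.
apply: (convex_comb cS _ (sum_bmx hconst t i)) => j; last exact: SX.
exact: (bmx_ge0 hEA hconst).
Qed.
Let Sy t : S (y t). Proof. by exists (xstar t). Qed.

Let al0 t : 0 <= alpha t. Proof. by rewrite halpha divr_ge0// mulr_ge0// sqrtr_ge0. Qed.
Let lip := cost_lipschitz hf hC.
Let G0 : 0 < G := subgradient_bound_gt0 hC.
Let R0 : 0 < Rb := outer_radius_gt0 hC.
Let le_Rb x : Omega x -> enorm x <= Rb. Proof. exact: (outer_ball hC). Qed.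
Let m0R : 0 < m%:R :> R. Proof. by rewrite ltr0n. Qed.

Let eps t := alpha t * theta * (m%:R * G).
Let epsE t : eps t = theta * G * (Num.sqrt t.+1%:R)^-1.
Proof.
rewrite /eps halpha; have : Num.sqrt t.+1%:R != 0 :> R by rewrite gt_eqF// sqrtr_gt0 ltr0n.
by have := lt0r_neq0 m0R; move: (m%:R) (Num.sqrt _) => a b a0 b0; field; rewrite a0 b0.
Qed.

Let s0 := \sum_i enorm (X 0%N i).
Let dev t := C * deviation (n := n) lambda eps s0 t.

Let e_le t i : enorm (X t.+1 i - V t i) <= eps t.
Proof. exact: (displacement hconst cS (al0 t) (gK t) (XS t) (SV t i)). Qed.

Let potential t z := \sum_i phi A t i 0 * enorm (X t i - z) ^+ 2.

(** [D1] pays for evaluating all costs at node [j], [D2] for shrinking the comparator into [S], [D3]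
    for replacing the iterates by their mixtures [V]. [D4] is the Lyapunov inequality divided by 2
    alpha_t, hence the factor [m%:R / 2] times a square root. *)
Lemma regret_step t j :
  total_cost f t (X t j) - total_cost f t (xstar t) <=
    \sum_i (f i t (X t i) - f i t (y t) - edot (g t i) (X t i - y t))
    + n%:R * G * (2 + m%:R * (1 + lambda)) * dev t
    + m%:R / 2 * (Num.sqrt t.+1%:R * (potential t (y t) - potential t.+1 (y t)))
    + n%:R * theta * m%:R * G ^+ 2 / 2 * (Num.sqrt t.+1%:R)^-1 + n%:R * G * Rb * xi.
Proof.
have nsum (c : R) : n%:R * c = \sum_(i < n) c by rewrite sumr_const card_ord mulr_natl.
have D1 : total_cost f t (X t j) - \sum_i f i t (X t i) <= n%:R * (G * (2 * dev t)).
  rewrite nsum -sumrB; apply: ler_sum => i _.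
  apply: le_trans (lip _ _ _ (SO (SX t j))) _; rewrite ler_wpM2l ?(ltW G0)//.
  by rewrite /dev mulrA; exact: (node_distance hconst e_le).
have D2 : \sum_i f i t (y t) - total_cost f t (xstar t) <= n%:R * (G * (xi * Rb)).
  rewrite nsum -sumrB; apply: ler_sum => i _.
  apply: le_trans (lip _ _ _ (SO (Sy t))) _; rewrite ler_wpM2l ?(ltW G0)//.
  rewrite /y scalerBl scale1r addrAC subrr add0r enormN enormZ ger0_norm//.
  by rewrite ler_wpM2l// le_Rb.
have D3 : \sum_i edot (g t i) (X t i - V t i) <= n%:R * (m%:R * G * ((1 + lambda) * dev t)).
  rewrite nsum; apply: ler_sum => i _; apply: le_trans (edot_le _ _) _.
  rewrite ler_pM ?enorm_ge0// enormBC /dev mulrA; exact: (combined_distance hconst e_le).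
have D4 := lyapunov_step hEA hG hconst cS (gK t) (XS t) (Sy t).
have sq0 : 0 < Num.sqrt t.+1%:R :> R by rewrite sqrtr_gt0 ltr0n.
have {}D4 : \sum_i edot (g t i) (V t i - y t) <=
    m%:R / 2 * (Num.sqrt t.+1%:R * (potential t (y t) - potential t.+1 (y t)))
    + n%:R * theta * m%:R * G ^+ 2 / 2 * (Num.sqrt t.+1%:R)^-1.
  move: D4; rewrite -/(potential t.+1 (y t)) -/(potential t (y t)).
  set Sg := \sum_i _; set p1 := potential _ _; set p2 := potential _ _ => D4.
  have c0 : 0 <= m%:R * Num.sqrt t.+1%:R / 2 :> R by rewrite divr_ge0// mulr_ge0 ?ltW.
  move: (ler_wpM2l c0 D4); rewrite halpha.
  have := lt0r_neq0 m0R; have := lt0r_neq0 sq0.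
  move: (m%:R) (Num.sqrt _) => a b b0 a0.
  have -> : a * b / 2 * (p2 - 2 * (1 / (a * b)) * Sg
      + (1 / (a * b)) ^+ 2 * (n%:R * (theta * (a * G) ^+ 2))) =
    a * b / 2 * p2 - Sg + n%:R * theta * a * G ^+ 2 / 2 * b^-1.
    by field; rewrite a0 b0.
  lra.
have -> : \sum_i (f i t (X t i) - f i t (y t) - edot (g t i) (X t i - y t)) =
   \sum_i f i t (X t i) - \sum_i f i t (y t) - (\sum_i edot (g t i) (X t i - V t i)
   + \sum_i edot (g t i) (V t i - y t)).
  rewrite -big_split -!sumrB; apply: eq_bigr => i _ /=; rewrite -edotDr.
  by rewrite addrA subrK.
lra.
Qed.

Lemma pathwise_regret j :
  \sum_(0 <= t < T.+1) (total_cost f t (X t j) - total_cost f t (xstar t)) <=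
  \sum_(0 <= t < T.+1) \sum_i (f i t (X t i) - f i t (y t) - edot (g t i) (X t i - y t))
  + n%:R * C * (G * (2 + m%:R * (1 + lambda))) / (1 - lambda)
      * (s0 + n%:R * (2 * theta * G * Num.sqrt T.+1%:R))
  + 2 * n%:R * m%:R * Rb * (Rb + path_variation xstar T) * Num.sqrt T.+1%:R
  + n%:R * theta * m%:R * G ^+ 2 * Num.sqrt T.+1%:R
  + n%:R * G * Rb * (xi * T.+1%:R).
Proof.
have [C0 /andP[l0 l1] th0 _ _] := hconst.
set q := Num.sqrt T.+1%:R.
have q_sum : \sum_(0 <= t < T.+1) (Num.sqrt t.+1%:R)^-1 <= 2 * q := sum_invsqrt_le R T.+1.
have eps0 t : 0 <= eps t by rewrite epsE !mulr_ge0 ?invr_ge0 ?sqrtr_ge0// ltW.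
have dev_sum : \sum_(0 <= t < T.+1) dev t <=
    C * ((s0 + n%:R * (2 * theta * G * q)) / (1 - lambda)).
  rewrite -mulr_sumr ler_wpM2l ?(ltW C0)//.
  apply: le_trans (sum_deviation_le hconst X T.+1 eps0) _.
  rewrite ler_wpM2r ?invr_ge0 ?subr_ge0 ?(ltW l1)// lerD2l ler_wpM2l ?ler0n//.
  under eq_bigr do rewrite epsE; rewrite -mulr_sumr.
  by have := ler_wpM2l (mulr_ge0 (ltW th0) (ltW G0)) q_sum; lra.
have bound t i z : S z -> enorm (X t i - z) <= 2 * Rb.
  move=> Sz; rewrite (le_trans (enormB _ _))//.
  by have := le_Rb (SO (SX t i)); have := le_Rb (SO Sz); lra.
(* The weights phi sum to [n] and distances are at most 2 Rb, so potentials are at most 4 n Rb^2.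
   Moving the comparator changes a square by (c - b) (c + b), with c + b <= 4 Rb. *)
have pot_sum : \sum_(0 <= t < T.+1) Num.sqrt t.+1%:R *
    (potential t (y t) - potential t.+1 (y t)) <=
    q * (4 * n%:R * Rb ^+ 2
      + \sum_(0 <= t < T.+1) 4 * n%:R * Rb * enorm (xstar t.+1 - xstar t)).
  apply: (abel_telescope (c := fun t => Num.sqrt t.+1%:R)
     (a := fun t => potential t (y t)) (b := fun t => potential t.+1 (y t))).
  - by move=> t; exact: sqrtr_ge0.
  - by move=> t; rewrite ler_wsqrtr// ler_nat.
  - move=> t; apply: sumr_ge0 => i _; rewrite mulr_ge0 ?sqr_ge0//.
    exact: ltW (phi_gt0 hconst t i).
  - move=> t; rewrite mulrAC mulrC -(sum_phi hG t) mulr_suml.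
    apply: ler_sum => i _; rewrite ler_wpM2l ?(ltW (phi_gt0 hconst t i))//.
    by have := bound t i (y t) (Sy t); have := enorm_ge0 (X t i - y t); nra.
  - by move=> t; rewrite !mulr_ge0 ?enorm_ge0// ltW.
  - move=> t; rewrite -[4 * n%:R * Rb * _]mulrA mulrAC mulrC.
    rewrite -(sum_phi hG t.+1) mulr_suml -big_split.
    apply: ler_sum => i _ /=; rewrite -mulrDr ler_wpM2l ?(ltW (phi_gt0 hconst t.+1 i))//.
    have : enorm (X t.+1 i - y t.+1) <= enorm (X t.+1 i - y t) + enorm (xstar t.+1 - xstar t).
      rewrite (_ : X t.+1 i - y t.+1 = X t.+1 i - y t - (y t.+1 - y t)); last first.
        by apply/rowP => k; rewrite !mxE; ring.
      rewrite (le_trans (enormB _ _))// lerD2l /y -scalerBr enormZ ger0_norm ?subr_ge0//.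
      by rewrite ler_piMl ?enorm_ge0// gerBl.
    have := bound t.+1 i _ (Sy t); have := bound t.+1 i _ (Sy t.+1).
    have := enorm_ge0 (X t.+1 i - y t.+1); have := enorm_ge0 (X t.+1 i - y t).
    have := enorm_ge0 (xstar t.+1 - xstar t).
    set a := enorm _; set b := enorm (_ - y t); set c := enorm (_ - y t.+1).
    move=> a0 b0 c0 c2 b2 cab; have [cb|bc] := leP c b.
      have : c ^+ 2 <= b ^+ 2 by rewrite ler_sqr.
      by have := mulr_ge0 (ltW R0) a0; lra.
    have : (c - b) * (c + b) <= a * (4 * Rb) by rewrite ler_pM; lra.
    lra.
have H t : true -> _ := fun _ => regret_step t j.
apply: le_trans (ler_sum _ H) _.
rewrite !big_split/= -!mulr_sumr sumr_const_nat subn0 -[_ *+ T.+1]mulr_natr.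
rewrite -mulr_sumr -/(path_variation xstar T) in pot_sum; rewrite -mulr_sumr in dev_sum.
have k1 : 0 <= n%:R * G * (2 + m%:R * (1 + lambda)).
  by rewrite !mulr_ge0 ?ler0n ?(ltW G0)// addr_ge0// mulr_ge0 ?ler0n// addr_ge0// ltW.
have k2 : 0 <= n%:R * theta * m%:R * G ^+ 2 / 2.
  by rewrite divr_ge0// mulr_ge0 ?sqr_ge0// !mulr_ge0 ?ler0n// ltW.
have k3 : 0 <= m%:R / 2 :> R by rewrite divr_ge0 ?ler0n.
have := ler_wpM2l k1 dev_sum; have := ler_wpM2l k3 pot_sum; have := ler_wpM2l k2 q_sum.
lra.
Qed.

End PathwiseRegret.

(** Since L = m G q / r with r <= Rb and q >= 1, the product Rb L is at least m G; this absorbs G (2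
    + m (1 + lambda)). The other comparisons rest on theta >= 1. As T1 = q^2, the terms carrying xi
    and mu are of order q. *)
Lemma regret_constants (R : realType) (n m : nat) (C lambda theta r Rb G s0 pv q T1 : R) :
  (0 < m)%N -> 0 < C -> 0 < lambda -> lambda < 1 -> 1 <= theta -> 0 < r -> r <= Rb ->
  0 < G -> 0 <= s0 -> 1 <= q -> T1 = q ^+ 2 ->
  let L := m%:R * G / (r / q) in
  n%:R * C * (G * (2 + m%:R * (1 + lambda))) / (1 - lambda)
      * (s0 + n%:R * (2 * theta * G * q))
  + 2 * n%:R * m%:R * Rb * (Rb + pv) * q
  + n%:R * theta * m%:R * G ^+ 2 * q + n%:R * G * Rb * (1 / q * T1)
  + n%:R * (r / q * G) * T1 <=
  n%:R * C * (2 * Rb * L * theta + 2 * m%:R * theta * lambda * G + G) / (1 - lambda) * s0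
    + 2 * n%:R ^+ 2 * theta * C * G * Rb / (lambda * (1 - lambda))
  + (2 * n%:R ^+ 2 * theta * C * G / (1 - lambda)
      * (2 * theta * Rb * L + 2 * m%:R * theta * G + G)
    + n%:R * m%:R * theta ^+ 2 * G ^+ 2 + 2 * n%:R * m%:R * Rb ^+ 2
    + n%:R * r * theta * G + n%:R * theta * G * Rb
    + 2 * n%:R * m%:R * Rb * pv) * q.
Proof.
move=> m0 C0 l0 l1 th1 r0 rR G0 s00 q1 -> /=; set L := _ / (r / q).
have q0 : 0 < q by lra.
have qT : 1 / q * q ^+ 2 = q by field; rewrite gt_eqF.
have rT : n%:R * (r / q * G) * q ^+ 2 = n%:R * r * G * q by field; rewrite gt_eqF.
have m1 : 1 <= m%:R :> R by rewrite ler1n.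
have n0 : 0 <= n%:R :> R by rewrite ler0n.
have iv0 : 0 < (1 - lambda)^-1 by rewrite invr_gt0 subr_gt0.
have Rb0 : 0 < Rb by lra.
have RL : m%:R * G <= Rb * L.
  have -> : Rb * L = Rb / r * q * (m%:R * G) by rewrite /L; field; rewrite !gt_eqF.
  rewrite ler_peMl ?mulr_ge0 ?ler0n ?(ltW G0)//.
  by rewrite mulr_ege1// ler_pdivlMr// mul1r.
have mG : G <= m%:R * G by rewrite ler_peMl// ltW.
have RLth : Rb * L <= Rb * L * theta by rewrite ler_peMr//; lra.
have mlG : m%:R * lambda * G <= m%:R * theta * lambda * G.
  by rewrite -!mulrA ler_wpM2l ?ler0n// ler_peMl// mulr_ge0// ltW.
have mlG0 : 0 <= m%:R * lambda * G by rewrite !mulr_ge0// ltW.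
have mtG : m%:R * G <= m%:R * theta * G.
  by rewrite -mulrA ler_wpM2l ?ler0n// ler_peMl// ltW.
have mlG1 : m%:R * lambda * G <= m%:R * G.
  by rewrite -mulrA ler_wpM2l ?ler0n// ler_piMl// ltW.
have k1 : G * (2 + m%:R * (1 + lambda)) <=
    2 * Rb * L * theta + 2 * m%:R * theta * lambda * G + G.
  by lra.
have k2 : G * (2 + m%:R * (1 + lambda)) <= 2 * theta * Rb * L + 2 * m%:R * theta * G + G.
  by lra.
have c1 : 0 <= n%:R * C * (1 - lambda)^-1 * s0 by rewrite !mulr_ge0// ltW.
have c2 : 0 <= 2 * n%:R ^+ 2 * theta * C * G * (1 - lambda)^-1 * q.
  by rewrite !mulr_ge0 ?exprn_ge0// ltW//; lra.
have := ler_wpM2l c1 k1; have := ler_wpM2l c2 k2.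
have c3 : 0 <= 2 * n%:R ^+ 2 * theta * C * G * Rb / (lambda * (1 - lambda)).
  by rewrite divr_ge0 ?mulr_ge0 ?exprn_ge0 ?subr_ge0// ltW//; lra.
have th0 : 0 <= theta by lra.
have c4 : 0 <= (theta - 1) * (n%:R * m%:R * theta * G ^+ 2 * q).
  by rewrite mulr_ge0 ?subr_ge0// !mulr_ge0 ?ler0n ?exprn_ge0// ltW.
have c5 : 0 <= (theta - 1) * (n%:R * G * q * (r + Rb)).
  by rewrite mulr_ge0 ?subr_ge0// !mulr_ge0// ?addr_ge0// ltW.
rewrite qT rT; move: c3; set K3 := _ / (lambda * _); set iv := (1 - lambda)^-1.
lra.
Qed.

(** * Expected regret *)

Section RealIntegrals.
Context {d : measure_display} {W : measurableType d} {R : realType}.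
Variable P : probability W R.

Lemma integrable_real_sum (I : Type) (s : seq I) (F : I -> W -> R) :
  (forall i, P.-integrable setT (EFin \o F i)) ->
  P.-integrable setT (EFin \o (fun w => \sum_(i <- s) F i w)).
Proof.
move=> iF; have := @integrable_sum _ _ _ P setT measurableT I s xpredT _ (fun i _ => iF i).
by congr (P.-integrable _ _); apply/funext => w /=; rewrite sumEFin.
Qed.

Lemma Rintegral_sum (I : Type) (s : seq I) (F : I -> W -> R) :
  (forall i, P.-integrable setT (EFin \o F i)) ->
  \int[P]_w (\sum_(i <- s) F i w) = \sum_(i <- s) \int[P]_w F i w.
Proof.
move=> iF; elim: s => [|i s IH].
  under eq_Rintegral do rewrite big_nil.
  by rewrite Rintegral_cst// mul0r big_nil.
under eq_Rintegral do rewrite big_cons.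
by rewrite RintegralD ?IH ?big_cons//; exact: integrable_real_sum.
Qed.

Lemma le_Rintegral_outside (N : set W) (f g : W -> R) :
  measurable N -> P N = 0%E ->
  P.-integrable setT (EFin \o f) -> P.-integrable setT (EFin \o g) ->
  (forall w, ~ N w -> f w <= g w) -> \int[P]_w f w <= \int[P]_w g w.
Proof.
move=> mN PN fi gi fg; rewrite /Rintegral.
rewrite (negligible_integral mN measurableT fi PN) (negligible_integral mN measurableT gi PN).
have mD : measurable ([set: W] `\` N) by exact: measurableD.
have sub (h : W -> R) : P.-integrable setT (EFin \o h) ->
    P.-integrable ([set: W] `\` N) (EFin \o h).
  by apply: integrableS => //; exact: measurableT.
apply: (@le_Rintegral _ _ _ P _ f g mD (sub _ fi) (sub _ gi)) => w [_ nN].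
exact: fg.
Qed.

End RealIntegrals.

Section Stochastic.
Context {R : realType} {n m : nat} (E : nat -> rel 'I_n) (A : nat -> 'M[R]_n).
Hypotheses (hEA : weighted_digraphs E A) (hG : network_assumption E A).
Variables (C lambda theta : R) (hconst : mixing_constants A C lambda theta).
Variables (Omega : set 'rV[R]_m) (f : 'I_n -> nat -> 'rV[R]_m -> R).
Hypothesis hf : forall i t, convex_function setT (f i t).
Variables (r Rb G : R) (hC : cost_assumption Omega f r Rb G).
Context {d : measure_display} {W : measurableType d} (P : probability W R).
Variable zeta : 'I_n -> nat -> W -> 'rV[R]_m.
Hypotheses (hindep : mutually_independent P (fun k : 'I_n * nat => zeta k.1 k.2))
  (hunif : forall i t, uniform_on_sphere P (zeta i t)).
Variables (mu xi : R) (alpha : nat -> R).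
Hypotheses (xi0 : 0 < xi) (xi1 : xi <= 1) (muE : mu = r * xi).
Variables (x0 : 'I_n -> 'rV[R]_m) (x : 'I_n -> nat -> W -> 'rV[R]_m).
Hypothesis hx : generated_iterates A Omega f xi mu alpha zeta x0 x.

Let r0 : 0 < r := inner_radius_gt0 hC.
Let mu0 : 0 < mu. Proof. by rewrite muE mulr_gt0. Qed.
Let G0 : 0 < G := subgradient_bound_gt0 hC.

Local Notation H t := (g_sigma_algebraType (past zeta t)).
Local Notation V := (g_sigma_algebraType [set U : set 'rV[R]_m | open U]).

Lemma iterate_feasible i t w : dilate (1 - xi) Omega (x i t w).
Proof.
case: t => [|t]; first by rewrite (initial_point hx); exact: initial_feasible hx _.
by case: (update hx i t w).
Qed.

Lemma feasible_shift i t w v : enorm v <= 1 -> Omega (x i t w + mu *: v).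
Proof. exact: (interior_shift hC (ltW xi0) xi1 muE (iterate_feasible i t w)). Qed.

Lemma iterate_in i t w : Omega (x i t w).
Proof. exact (dilate_sub hC (ltW xi0) xi1 (iterate_feasible i t w)). Qed.

Let zero_in : Omega 0.
Proof. by apply: (inner_ball hC); rewrite /eball/= enorm0 ltW. Qed.

Lemma cost_bound i t y : Omega y -> `|f i t y| <= `|f i t 0| + G * Rb.
Proof.
move=> Oy; have h1 := cost_lipschitz hf hC i t 0 Oy.
have h2 := cost_lipschitz hf hC i t y zero_in.
have yR : enorm y <= Rb by exact: outer_ball hC _ Oy.
have := ler_wpM2l (ltW G0) yR; rewrite sub0r enormN subr0 in h1 h2.
have := ler_norm (f i t 0); have := lerNnormlW (lexx `|f i t 0|).
by rewrite ler_norml => *; apply/andP; split; lra.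
Qed.

Lemma subgradient_near i t w j s z : enorm z <= 1 ->
  exists2 g, subdifferential (f j s) (x i t w + mu *: z) g & enorm g <= G.
Proof.
move=> z1; have [g fg] := subdifferential_nonempty (x i t w + mu *: z) (hf j s).
by exists g => //; exact: (subgradient_bound hC (feasible_shift i t w z1)).
Qed.

(** Over a displacement of length [mu] the cost changes by at most mu G, so the division by [mu] is
    harmless. *)
Lemma estimate_bound i t w j s z : enorm z = 1 ->
  enorm (gradient_estimate (f j s) mu z (x i t w)) <= m%:R * G.
Proof.
move=> z1; rewrite /gradient_estimate enormZ z1 mulr1 normrM.
rewrite ger0_norm ?divr_ge0 ?ler0n ?(ltW mu0)//.
rewrite -mulrA ler_wpM2l ?ler0n// mulrC ler_pdivrMr//.
have z1le : enorm z <= 1 by rewrite z1.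
have h1 := cost_lipschitz hf hC j s (x i t w) (feasible_shift i t w z1le).
have h2 := cost_lipschitz hf hC j s (x i t w + mu *: z) (iterate_in i t w).
have e1 : enorm (x i t w + mu *: z - x i t w) = mu.
  by rewrite addrAC subrr add0r enormZ z1 mulr1 gtr0_norm.
rewrite enormBC e1 in h2; rewrite e1 in h1.
by rewrite ler_norml; apply/andP; split; lra.
Qed.

Lemma measurable_direction i t s k : (s < t)%N ->
  measurable_fun [set: H t] (fun w => zeta i s w 0 k).
Proof.
move=> st _ B mB; rewrite setTI.
have mk : measurable ((fun v : V => v 0 k) @^-1` B).
  by rewrite -[X in measurable X]setTI; exact: measurable_coord.
by apply: sub_sigma_algebra; exists (i, s) => //; exists ((fun v => v 0 k) @^-1` B).
Qed.

Lemma measurable_past_mono s t (h : W -> R) : (s <= t)%N ->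
  measurable_fun [set: H s] h -> measurable_fun [set: H t] h.
Proof.
move=> st mh _ B mB; apply: (past_monotone st).
by have := mh measurableT B mB.
Qed.

Let sub_nonempty i t v : subdifferential (f i t) v !=set0.
Proof. exact: subdifferential_nonempty. Qed.

Lemma measurable_cost_iterate i j s t :
  (forall k, measurable_fun [set: H t] (fun w => x i s w 0 k)) ->
  measurable_fun [set: H t] (fun w => f j s (x i s w)).
Proof. by move=> mx; exact: (measurable_subdifferentiable mx). Qed.

Lemma measurable_estimate i t k :
  (forall l, measurable_fun [set: H t.+1] (fun w => x i t w 0 l)) ->
  measurable_fun [set: H t.+1]
    (fun w => gradient_estimate (f i t) mu (zeta i t w) (x i t w) 0 k).
Proof.
move=> mx; have mz l : measurable_fun [set: H t.+1] (fun w => zeta i t w 0 l).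
  exact: measurable_direction.
have mfz : measurable_fun [set: H t.+1] (f i t \o (fun w => x i t w + mu *: zeta i t w)).
  apply: measurable_subdifferentiable => // l.
  under eq_fun do rewrite !mxE.
  by apply: measurable_funD => //; apply: measurable_funM.
under eq_fun do rewrite mxE; apply: measurable_funM => //.
by apply: measurable_funM => //; apply: measurable_funB => //; exact: measurable_cost_iterate.
Qed.

(** The projection is a relation, not a given map. Nonexpansiveness makes the projected point depend
    continuously on the unprojected one, [Y], and the semicontinuity criterion applies. *)
Lemma measurable_iterate i t k : measurable_fun [set: H t] (fun w => x i t w 0 k).
Proof.
elim: t i k => [|t IH] i k.
  by under eq_fun do rewrite (initial_point hx); exact: measurable_cst.
pose Y w := \sum_j bmx A t i j *: x j t w
  - (alpha t / phi A t.+1 i 0) *: gradient_estimate (f i t) mu (zeta i t w) (x i t w).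
have mx j l : measurable_fun [set: H t.+1] (fun w => x j t w 0 l).
  exact: measurable_past_mono (leqnSn t) (IH j l).
have mY l : measurable_fun [set: H t.+1] (fun w => Y w 0 l).
  rewrite (_ : (fun w => Y w 0 l) = fun w => \sum_j bmx A t i j * x j t w 0 l
    - (alpha t / phi A t.+1 i 0)
        * gradient_estimate (f i t) mu (zeta i t w) (x i t w) 0 l); last first.
    apply/funext => w; rewrite /Y !mxE summxE; congr (_ - _).
    by apply: eq_bigr => j _; rewrite mxE.
  apply: measurable_funB; last by apply: measurable_funM => //; exact: measurable_estimate.
  by apply: measurable_sum => j; apply: measurable_funM.
apply: (measurable_semicontinuous mY) => w a aw.
pose e := (x i t.+1 w 0 k - a) / (m%:R + 1).
have m1 : 0 < m%:R + 1 :> R by rewrite ltr_wpDl.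
have e0 : 0 < e by rewrite divr_gt0// subr_gt0.
have eE : e * (m%:R + 1) = x i t.+1 w 0 k - a by rewrite divfK// gt_eqF.
exists e => // w' ww'.
have := proj_nonexpansive (convex_dilate (constraint_convex hC))
  (update hx i t w) (update hx i t w').
rewrite -/(Y w) -/(Y w') => /(le_trans (coord_le_enorm _ k)).
have : enorm (Y w - Y w') <= m%:R * e.
  rewrite (le_trans (enorm_le_sum _))// -[m in m%:R]card_ord mulr_natl -sumr_const.
  by apply: ler_sum => l _; rewrite [(Y w - Y w') 0 l]mxE [X in _ + X]mxE ltW.
rewrite !mxE ler_norml => h1 /andP[_ h2]; lra.
Qed.

Lemma measurable_of_past t (h : W -> R) :
  measurable_fun [set: H t] h -> measurable_fun [set: W] h.
Proof.
move=> mh _ B mB; rewrite setTI; apply: (measurable_past hunif (t := t)).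
by have := mh measurableT B mB; rewrite setTI.
Qed.

Let S i t : set W := zeta i t @^-1` esphere.

Definition estimation_gap i t (y : 'rV[R]_m) (w : W) : R :=
  f i t (x i t w) - f i t y
  - edot (gradient_estimate (f i t) mu (zeta i t w) (x i t w)) (x i t w - y).

Lemma distance_in_ball i t w y : Omega y -> enorm (x i t w - y) <= 2 * Rb.
Proof.
move=> Oy; rewrite (le_trans (enormB _ _))//.
have : enorm (x i t w) <= Rb := outer_ball hC (iterate_in i t w).
by have : enorm y <= Rb := outer_ball hC Oy; lra.
Qed.

(** The iterate is measurable in the past of [t] and the direction of time [t] is independent of
    that past, which is the setting of [mean_gradient_estimate], with [U = 2 * Rb]. *)
Lemma mean_estimation_gap i t y : (0 < m)%N -> Omega y ->
  \int[P]_(w in S i t) estimation_gap i t y w <= mu * G.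
Proof.
move=> m0 Oy.
have hM := direction_mean_invariant (measurable_past hunif (t := t)) (hunif i t)
  (fun S0 B => @past_independent _ _ _ _ _ P zeta hindep hunif t i S0 B).
have mxi k : measurable_fun [set: H t] (fun w => x i t w 0 k) by exact: measurable_iterate.
have := @mean_gradient_estimate _ _ _ _ _ hM (f i t) (x i t) y mu G (2 * Rb) m0 mu0.
rewrite (_ : direction_mean _ _ _ = \int[P]_(w in S i t) estimation_gap i t y w); last first.
  apply: eq_Rintegral => w _; rewrite /estimation_gap /gradient_estimate edotZl.
  by [].
apply.
- by move=> w z; exact: subgradient_near.
- by move=> w; rewrite enormBC; exact: distance_in_ball.
- move=> k; split; first exact: measurableT_comp (mxi k) measurable_fst.
  exists Rb => w z _; apply: le_trans (coord_le_enorm _ _) _.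
  exact: outer_ball hC _ (iterate_in i t w).
- move=> u u1; split.
    apply: (@measurable_subdifferentiable _ _ _ _
      (fun p : H t * V => x i t p.1 + (u * mu) *: (p.2 : 'rV[R]_m))) => // k.
    rewrite [X in measurable_fun _ X](_ : _ = fun p =>
        x i t p.1 0 k + u * mu * (p.2 : 'rV[R]_m) 0 k); last first.
      by apply/funext => p; rewrite !mxE.
    apply: measurable_funD; first exact: measurableT_comp (mxi k) measurable_fst.
    apply: measurable_funM => //; exact: measurableT_comp (measurable_coord k) measurable_snd.
  exists (`|f i t 0| + G * Rb) => w z z1; apply: cost_bound.
  rewrite mulrC -scalerA; apply: feasible_shift.
  by rewrite enormZ z1 mulr1.
Qed.

Lemma integrable_bounded (D : set W) (h : W -> R) K : measurable D ->
  measurable_fun [set: W] h -> (forall w, D w -> `|h w| <= K) ->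
  P.-integrable D (EFin \o h).
Proof.
move=> mD mh hK; apply: measurable_bounded_integrable => //.
- by rewrite (le_lt_trans (probability_le1 P mD))// ltry.
- exact: measurable_funTS.
- exists `|K|; split; first by rewrite num_real.
  move=> r1 Kr w Dw; apply/ltW; apply: le_lt_trans Kr.
  exact: le_trans (hK _ Dw) (ler_norm _).
Qed.

Lemma measurable_sphere i t : measurable (S i t).
Proof. by case: (hunif i t) => + _ _; apply; exact: borel_esphere. Qed.

Lemma integrable_estimation_gap i t y : Omega y ->
  P.-integrable (S i t) (EFin \o estimation_gap i t y).
Proof.
move=> Oy; have mx l : measurable_fun [set: H t.+1] (fun w => x i t w 0 l).
  exact: measurable_past_mono (leqnSn t) (@measurable_iterate i t l).
apply: (@integrable_bounded _ _ (2 * (`|f i t 0| + G * Rb) + m%:R * G * (2 * Rb))).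
- exact: measurable_sphere.
- apply: (@measurable_of_past t.+1); apply: measurable_funB.
    by apply: measurable_funB => //; exact: measurable_cost_iterate.
  apply: measurable_edot => k; first exact: measurable_estimate.
  by under eq_fun do rewrite !mxE; apply: measurable_funB.
move=> w Sw; rewrite /estimation_gap (le_trans (ler_normB _ _))// lerD//.
  rewrite (le_trans (ler_normB _ _))// mulr_natl mulr2n lerD//; apply: cost_bound => //.
  exact: iterate_in.
rewrite (le_trans (norm_edot _ _))// ler_pM ?enorm_ge0 ?distance_in_ball//.
exact: estimate_bound.
Qed.

Lemma integrable_total_cost j t :
  P.-integrable setT (EFin \o (fun w => total_cost f t (x j t w))).
Proof.
apply: integrable_real_sum => i.
apply: (@integrable_bounded _ _ (`|f i t 0| + G * Rb)) => //.
  apply: (@measurable_of_past t); apply: measurable_cost_iterate => k.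
  exact: measurable_iterate.
by move=> w _; apply: cost_bound; exact: iterate_in.
Qed.

End Stochastic.

Lemma expectation_Rintegral (d : measure_display) (W : measurableType d) (R : realType)
    (P : probability W R) (X : W -> R) :
  P.-integrable setT (EFin \o X) -> 'E_P[X]%E = (\int[P]_w X w)%:E.
Proof.
by move=> iX; rewrite unlock /Rintegral fineK//; exact: integrable_fin_num.
Qed.

(** The pairs of a node and a time are countably many; enumerating them gives one null set valid for
    all. *)
Lemma directions_ae_unit (d : measure_display) (W : measurableType d) (R : realType)
    (P : probability W R) n m (zeta : 'I_n -> nat -> W -> 'rV[R]_m) :
  (forall i t, uniform_on_sphere P (zeta i t)) ->
  exists N, [/\ measurable N, P N = 0%E &
    forall w, ~ N w -> forall i t, enorm (zeta i t w) = 1].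
Proof.
move=> hunif; pose F k := if choice.unpickle k is Some (i, t) then
  ~` (zeta i t @^-1` esphere) else (set0 : set W).
have [N [mN PN FN]] : P.-negligible (\bigcup_k F k).
  apply: negligible_bigcup => k; rewrite /F.
  case: choice.unpickle => [[i t]|]; last exact: negligible_set0.
  have mS := measurable_sphere hunif i t; have [_ PS _] := hunif i t.
  apply/negligibleP; first exact: measurableC.
  by apply: etrans (probability_setC _ mS) _; rewrite PS subee.
exists N; split => // w nN i t; apply: contrapT => nS; apply: nN; apply: FN.
by exists (choice.pickle (i, t)) => //; rewrite /F choice.pickleK.
Qed.

(** In dimension 0 the sphere is empty and cannot have probability one. *)
Lemma uniform_on_sphere_dim_gt0 (d : measure_display) (W : measurableType d)
    (R : realType) (P : probability W R) m (Z : W -> 'rV[R]_m) :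
  uniform_on_sphere P Z -> (0 < m)%N.
Proof.
case: m Z => // Z [_ PS _]; exfalso; move: PS.
rewrite (_ : _ @^-1` _ = set0) ?measure0; first by move=> [/eqP]; rewrite eq_sym oner_eq0.
apply/seteqP; split => w //=; rewrite (_ : Z w = 0); last by apply/rowP => -[].
by rewrite /esphere/= enorm0 => /eqP; rewrite eq_sym oner_eq0.
Qed.

Theorem theorem2 (R : realType) (n m : nat)
    (E : nat -> rel 'I_n) (A : nat -> 'M[R]_n)
    (hEA : weighted_digraphs E A)
    (hG : network_assumption E A)
    (C lambda theta : R) (hconst : mixing_constants A C lambda theta)
    (Omega : set 'rV[R]_m) (f : 'I_n -> nat -> 'rV[R]_m -> R)
    (hf : forall i t, convex_function setT (f i t))
    (r Rb G : R) (hC : cost_assumption Omega f r Rb G)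
    (xstar : nat -> 'rV[R]_m)
    (hxstar : forall t, is_argmin Omega (total_cost f t) (xstar t))
    (d : measure_display) (W : measurableType d) (P : probability W R)
    (zeta : 'I_n -> nat -> W -> 'rV[R]_m)
    (hindep : mutually_independent P
                (fun k : 'I_n * nat => zeta k.1 k.2))
    (hunif : forall i t, uniform_on_sphere P (zeta i t))
    (T : nat) (hT : (0 < T)%N)
    (mu xi : R) (hmu : mu = r / Num.sqrt T.+1%:R)
    (hxi : xi = 1 / Num.sqrt T.+1%:R)
    (alpha : nat -> R)
    (halpha : forall t, alpha t = 1 / (m%:R * Num.sqrt t.+1%:R))
    (x0 : 'I_n -> 'rV[R]_m) (x : 'I_n -> nat -> W -> 'rV[R]_m)
    (hx : generated_iterates A Omega f xi mu alpha zeta x0 x) :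
  let L := m%:R * G / mu in
  let K1 :=
    n%:R * C * (2 * Rb * L * theta + 2 * m%:R * theta * lambda * G + G)
      / (1 - lambda) * \sum_i enorm (x0 i)
    + 2 * n%:R ^+ 2 * theta * C * G * Rb / (lambda * (1 - lambda)) in
  let K2 :=
    2 * n%:R ^+ 2 * theta * C * G / (1 - lambda)
      * (2 * theta * Rb * L + 2 * m%:R * theta * G + G)
    + n%:R * m%:R * theta ^+ 2 * G ^+ 2 + 2 * n%:R * m%:R * Rb ^+ 2
    + n%:R * r * theta * G + n%:R * theta * G * Rb
    + 2 * n%:R * m%:R * Rb * path_variation xstar T in
  forall j : 'I_n,
    (dynamic_regret P (total_cost f) xstar (x j) T
       <= (K1 + K2 * Num.sqrt T.+1%:R)%:E)%E.
Proof.
move=> L K1 K2 j; have [C0 /andP[l0 l1] th0 _ _] := hconst.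
have m0 := uniform_on_sphere_dim_gt0 (hunif j 0%N).
have r0 := inner_radius_gt0 hC; have G0 := subgradient_bound_gt0 hC.
set q := Num.sqrt T.+1%:R.
have q1 : 1 <= q by rewrite -[1]sqrtr1 ler_wsqrtr// ler1n.
have q0 : 0 < q by lra.
have qq : T.+1%:R = q ^+ 2 by rewrite sqr_sqrtr// ler0n.
have xi0 : 0 < xi by rewrite hxi divr_gt0.
have xi1 : xi <= 1 by rewrite hxi ler_pdivrMr// mul1r.
have muE : mu = r * xi by rewrite hmu hxi mul1r.
have Ox t : Omega (xstar t) by case: (hxstar t).
(* The inner ball is compared with the outer one along a coordinate vector, available because [m] is
   positive. *)
have rR : r <= Rb.
  have e1 : enorm (delta_mx 0 (Ordinal m0) : 'rV[R]_m) = 1.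
    by rewrite /enorm edot_delta mxE !eqxx sqrtr1.
  have := outer_ball hC (inner_ball hC (_ : eball r (r *: delta_mx 0 (Ordinal m0)))).
  by rewrite /eball/= enormZ e1 mulr1 gtr0_norm// => /(_ (lexx _)).
have Oy t : Omega ((1 - xi) *: xstar t).
  by apply: (dilate_sub hC (ltW xi0) xi1); exists (xstar t).
have [N [mN PN unit_dir]] := directions_ae_unit hunif.
(* Extended by zero where the direction is not of unit length: integrable on all of [W], and equal
   to the true gap off [N]. *)
pose gap i t := estimation_gap f zeta mu x i t ((1 - xi) *: xstar t)
  \_ (zeta i t @^-1` esphere).
have igap i t : P.-integrable setT (EFin \o gap i t).
  have := integrable_estimation_gap hf hC hunif xi0 xi1 muE hx i t (Oy t).
  move=> /(integrable_mkcond _ (measurable_sphere hunif i t)).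
  by congr (P.-integrable _ _); rewrite restrict_EFin.
have gap_le i t : \int[P]_w gap i t w <= mu * G.
  rewrite -Rintegral_mkcond.
  exact: (mean_estimation_gap hf hC hindep hunif xi0 xi1 muE hx i t m0 (Oy t)).
have icost t : P.-integrable setT (EFin \o (fun w => total_cost f t (x j t w))).
  exact: (integrable_total_cost hf hC hunif xi0 xi1 hx j t).
pose c := n%:R * C * (G * (2 + m%:R * (1 + lambda))) / (1 - lambda)
      * (\sum_i enorm (x0 i) + n%:R * (2 * theta * G * q))
  + 2 * n%:R * m%:R * Rb * (Rb + path_variation xstar T) * q
  + n%:R * theta * m%:R * G ^+ 2 * q + n%:R * G * Rb * (xi * T.+1%:R).
have path w : ~ N w -> \sum_(0 <= t < T.+1) total_cost f t (x j t w) <=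
    \sum_(0 <= t < T.+1) \sum_i gap i t w
    + (c + \sum_(0 <= t < T.+1) total_cost f t (xstar t)).
  move=> nN; have := @pathwise_regret _ _ _ _ _ hEA hG _ _ _ hconst _ _ _ _ _ xstar T xi alpha
    hf hC Ox m0 (ltW xi0) xi1 halpha (fun t i => x i t w)
    (fun t i => gradient_estimate (f i t) mu (zeta i t w) (x i t w)) _ _ _ j.
  rewrite sumrB (eq_bigr (fun i => enorm (x0 i))); last first.
    by move=> i _; rewrite (initial_point hx).
  have -> : \sum_(0 <= t < T.+1) \sum_i gap i t w = \sum_(0 <= t < T.+1)
      \sum_i (f i t (x i t w) - f i t ((1 - xi) *: xstar t)
        - edot (gradient_estimate (f i t) mu (zeta i t w) (x i t w))
            (x i t w - (1 - xi) *: xstar t)).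
    apply: eq_bigr => t _; apply: eq_bigr => i _; rewrite /gap patchE mem_set//.
    exact: unit_dir.
  rewrite /c => H; rewrite addrA -lerBlDr; apply: le_trans (H _ _ _) _.
  - by move=> i; rewrite (initial_point hx); exact: initial_feasible hx i.
  - by move=> t i; exact: update hx i t w.
  - move=> t i; apply: (estimate_bound hf hC xi0 xi1 muE hx); exact: unit_dir.
  by rewrite -!addrA.
rewrite /dynamic_regret; under eq_bigr do rewrite expectation_Rintegral//.
rewrite sumEFin -EFinB lee_fin -Rintegral_sum//.
have igaps t : P.-integrable setT (EFin \o (fun w => \sum_i gap i t w)).
  exact: integrable_real_sum.
have icst k : P.-integrable setT (EFin \o (fun _ : W => k)).
  exact: finite_measure_integrable_cst.
have cstE k : \int[P]_(_ in setT) k = k.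
  by transitivity (k * fine (P setT)); [exact: Rintegral_cst|rewrite probability_setT mulr1].
have isum := integrable_real_sum (index_iota 0 T.+1) igaps.
have := le_Rintegral_outside mN PN (integrable_real_sum _ icost) _ path.
rewrite RintegralD// (Rintegral_sum _ igaps) cstE => int_le.
have {int_le} le1 := int_le (integrableD measurableT isum (icst _)).
(* There are n (T + 1) gaps, each of mean at most mu G; this is the last term on the left of
   [regret_constants]. *)
have gaps : \sum_(0 <= t < T.+1) \int[P]_w (\sum_i gap i t w) <= n%:R * (mu * G) * T.+1%:R.
  rewrite -[T.+1 in leRHS]subn0 mulr_natr -sumr_const_nat; apply: ler_sum => t _.
  rewrite Rintegral_sum// mulr_natl -[n in leRHS]card_ord -sumr_const.
  by apply: ler_sum => i _.
have s00 : 0 <= \sum_i enorm (x0 i) by apply: sumr_ge0 => i _; exact: enorm_ge0.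
have := @regret_constants R n m C lambda theta r Rb G (\sum_i enorm (x0 i))
  (path_variation xstar T) q T.+1%:R m0 C0 l0 l1 (theta_ge1 hconst j) r0 rR G0 s00 q1 qq.
rewrite /K1 /K2 /L /= -hmu; rewrite /c hxi in le1; rewrite hmu -/q in gaps *.
lra.
Qed.
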